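(* Both $\mathbb{R}\times\mathbb{R}$ and $\mathbb{A}\times\mathbb{A}$ are topologically sweet, but $$\Vdash_{\mathbb{R}}\text{ ''no dense subforcing of }(\mathbb{R}\times\mathbb{R}:\mathbb{R})\text{ (of }(\mathbb{R}\times\mathbb{A}:\mathbb{R})\text{, respectively) is topologically sweet''.}$$
   Context: $\mu^{\mathrm{Leb}}$ is the Lebesgue (product) measure on $2^\omega$. $\mathbb{R}$ is the random forcing: conditions are closed subsets of $2^\omega$ of positive Lebesgue measure, ordered by reverse inclusion (smaller sets are stronger, i.e. larger in the order). $\mathbb{A}$ is the amoeba for measure forcing: conditions are closed $F\subseteq 2^\omega$ with $\mu^{\mathrm{Leb}}(F)>\frac12$, ordered by reverse inclusion. Products carry the coordinatewise order, and $\mathbb{R}$ is regarded as a complete subforcing of the products $\mathbb{R}\times\mathbb{R}$ and $\mathbb{R}\times\mathbb{A}$ via the first coordinate. $\mathbf{BA}(\mathbb{P})$ is the complete Boolean algebra determined by $\mathbb{P}$. If $\mathbb{Q}$ is a complete subforcing of $\mathbf{BA}(\mathbb{P})$, the quotient $(\mathbb{P}:\mathbb{Q})$ is the $\mathbb{Q}$-name for the subforcing of $\mathbb{P}$ consisting of all $p\in\mathbb{P}$ (from the ground model) that are compatible in $\mathbf{BA}(\mathbb{P})$ with all members of the canonical generic filter $\Gamma_{\mathbb{Q}}$; i.e. $q\Vdash_{\mathbb{Q}}p\in(\mathbb{P}:\mathbb{Q})$ iff every $r\in\mathbb{Q}$ with $r\ge q$ is compatible with $p$ in $\mathbf{BA}(\mathbb{P})$.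 Topologically sweet: a forcing notion $\mathbb{P}$ (a preorder, larger conditions stronger, with weakest element $\emptyset_{\mathbb{P}}$ and no other condition equivalent to it) is topologically sweet if there is a countable basis $\mathcal{B}$ of a topology $\tau$ on $\mathbb{P}$ such that (i) $\emptyset_{\mathbb{P}}$ is an isolated point in $\tau$; (ii) if a sequence $\langle p_n:n<\omega\rangle\subseteq\mathbb{P}$ is $\tau$-converging to $p\in\mathbb{P}$, $q\ge p$ and $W$ is a $\tau$-neighbourhood of $q$, then there is $r\in\mathbb{P}$ such that $r\in W$, $r\ge q$, and the set $\{n\in\omega:p_n\le r\}$ is infinite. *)

(* Defs.v *)
From HB Require Import structures.
From mathcomp Require Import all_boot all_order all_algebra.
From mathcomp Require Import all_classical all_reals all_analysis.
From mathcomp Require Import lra ring zify.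

Set Implicit Arguments.
Unset Strict Implicit.
Unset Printing Implicit Defensive.

Import Order.TTheory GRing.Theory Num.Theory.
Import numFieldNormedType.Exports.
Local Open Scope classical_set_scope.
Local Open Scope ring_scope.

Definition cylinder (n : nat) (s : cantor_space) : set cantor_space :=
  [set x | forall i, (i < n)%N -> x i = s i].

Lemma open_cylinder (U : set cantor_space) (x : cantor_space) :
  open U -> U x -> exists n, cylinder n x `<=` U.
Proof.
move=> oU Ux; apply: contrapT => noc.
have /choice[y yP] : forall n, exists y, cylinder n x y /\ ~ U y.
  move=> n; apply: contrapT => ny; apply: noc; exists n => y cy.
  by apply: contrapT => nUy; apply: ny; exists y.
have yx : y @ \oo --> x.
  apply/cvg_sup => N V [W] [[B] oB <-] BxN BV.
  apply: (filterS BV); rewrite nbhs_simpl; exists N.+1 => // n /= Nn.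
  by have [/(_ N Nn)/= ->] := yP n.
have [N _ /(_ N (leqnn N))/=] : \forall n \near \oo, U (y n).
  by apply: yx; exact: open_nbhs_nbhs.
by have [] := yP N.
Qed.

Lemma open_cylinder_set (n : nat) (s : cantor_space) : open (cylinder n s).
Proof.
elim: n => [|n IH].
  by rewrite (_ : cylinder 0 s = setT) ?predeqE//; exact: openT.
have -> : cylinder n.+1 s = cylinder n s `&` (@proj nat (fun=> bool) n @^-1` [set s n]).
  apply/seteqP; split => x /= => [sx|[sx xn] i].
    by split; [move=> i ilt; apply: sx; exact: ltnW|exact: sx].
  by rewrite ltnS leq_eqVlt => /predU1P[->|]; [exact: xn|exact: sx].
apply: openI => //; apply: open_comp; last exact: discrete_open.
by move=> x _; exact: proj_continuous.
Qed.

Definition cantor_borel : Type := g_sigma_algebraType (@open cantor_space).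
HB.instance Definition _ := Measurable.on cantor_borel.

Definition binary_digits {R : realType} (x : measurableTypeR R) : cantor_borel :=
  fun n => odd (Num.truncn ((x : R) * 2 ^+ n.+1)).

Lemma measurable_binary_digits (R : realType) :
  measurable_fun setT (@binary_digits R).
Proof.
have mbit (n : nat) (b : bool) :
    measurable [set x : measurableTypeR R | binary_digits x n = b].
  have mk k : measurable [set x : measurableTypeR R |
      (Num.truncn (x * 2 ^+ n.+1) <= k)%N].
    rewrite (_ : [set _ | _] = `]-oo, (k.+1%:R / 2 ^+ n.+1)[%classic).
      exact: measurable_itv.
    apply/seteqP; split => x /=; rewrite in_itv/= truncn_le_nat ltr_pdivlMr//;
      exact: exprn_gt0.
  have -> : [set x : measurableTypeR R | binary_digits x n = b] =
    \bigcup_(k in [set k | odd k = b])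
      ([set x | (Num.truncn (x * 2 ^+ n.+1) <= k)%N] `\`
       [set x | (Num.truncn (x * 2 ^+ n.+1) < k)%N]).
    apply/seteqP; split => x /=.
      by move=> xb; exists (Num.truncn (x * 2 ^+ n.+1)) => //=; rewrite ltnn.
    move=> [k /= kb [xk /negP]]; rewrite -leqNgt => kx.
    by rewrite /binary_digits -kb; congr odd; apply/eqP; rewrite eqn_leq xk.
  apply: bigcup_measurable => -[|k] _.
    rewrite (_ : [set x | (_ < 0)%N] = set0) ?setD0; first exact: mk.
    by apply/seteqP; split.
  by apply: measurableD; exact: mk.
have := @measurability _ _ (measurableTypeR R) cantor_borel setT (@binary_digits R) (@open cantor_space).
apply => // _ [U oU <-].
rewrite setTI.
pose cyl (s : seq bool) : set cantor_space :=
  [set x | forall i, (i < size s)%N -> x i = nth false s i].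
have -> : binary_digits @^-1` U =
    \bigcup_(s in [set s | cyl s `<=` U]) (@binary_digits R @^-1` cyl s).
  apply/seteqP; split => x /=; last by move=> [s /= sU sx]; exact: sU.
  move=> /(open_cylinder oU)[n nU].
  exists (mkseq (binary_digits x) n) => /=; last first.
    by move=> i; rewrite size_mkseq => ilt; rewrite nth_mkseq.
  move=> y yc; apply: nU => i ilt; have := yc i; rewrite size_mkseq => ->//.
  by rewrite nth_mkseq.
pose F (s : seq bool) : set (measurableTypeR R) := @binary_digits R @^-1` cyl s.
rewrite -/F; have -> : \bigcup_(s in [set s | cyl s `<=` U]) F s =
    \bigcup_s (if `[< cyl s `<=` U >] then F s else set0).
  apply/seteqP; split => x /= [s]; first by exists s => //; case: asboolP.
  by case: asboolP => // sU _ Fx; exists s.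
apply: countable_bigcupT_measurable; first exact: countableP.
move=> s; case: ifP => // _.
have -> : F s = \bigcap_(i in `I_(size s)) [set x | binary_digits x i = nth false s i].
  by apply/seteqP; split => x /= sx i; exact: sx.
by apply: fin_bigcap_measurable => // i _; exact: mbit.
Qed.

HB.instance Definition _ (R : realType) :=
  isMeasurableFun.Build _ _ (measurableTypeR R) cantor_borel
    (@binary_digits R) (measurable_binary_digits (R := R)).

(* The Lebesgue (product, fair-coin) measure on 2^omega, realized as the law of
   the binary digits of a uniform point of [0, 1]; [leb_cylinder] identifies it
   as the product measure. *)
Definition leb (R : realType) : probability cantor_borel R :=
  distribution (uniform_prob (@ltr01 R)) (@binary_digits R).

Lemma leb_cylinder (R : realType) (n : nat) (s : cantor_space) :
  leb R (cylinder n s) = (2 ^- n)%:E.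
Proof.
pose k := fix k n := if n is m.+1 then (s m + (k m).*2)%N else 0%N.
have kn m : (k m < 2 ^ m)%N.
  elim: m => //= m IH; rewrite expnS; case: (s m) => /=; lia.
have half (x : R) m : 0 <= x ->
    (Num.truncn (x * 2 ^+ m.+1))./2 = Num.truncn (x * 2 ^+ m).
  move=> x0; apply/esym/eqP.
  have y0 : 0 <= x * 2 ^+ m by rewrite mulr_ge0// exprn_ge0.
  rewrite truncn_eq//; have := truncn_itv (mulr_ge0 x0 (exprn_ge0 m.+1 (ler0n _ 2))).
  rewrite exprSr mulrA; set y := x * _; set t := Num.truncn _.
  have : t%:R = (odd t)%:R + 2 * (t./2)%:R :> R.
    by rewrite -natrM -natrD mul2n odd_double_half.
  rewrite -[t.+1]addn1 -[t./2.+1]addn1 !natrD => ->.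
  by case: (odd t) => /= /andP[? ?]; apply/andP; split; lra.
have dig (x : R) : 0 <= x < 1 ->
    (forall i, (i < n)%N -> binary_digits x i = s i) <->
    Num.truncn (x * 2 ^+ n) = k n.
  move=> /andP[x0 x1]; elim: n => [|m IH].
    by rewrite mulr1; split => // _; apply: truncn_def; rewrite x0 x1.
  split.
    move=> h; have tm : Num.truncn (x * 2 ^+ m) = k m.
      by apply/IH => i im; apply: h; rewrite ltnS ltnW.
    rewrite -[LHS]odd_double_half half// tm /=; congr (nat_of_bool _ + _)%N.
    exact: (h m (ltnSn m)).
  rewrite -[X in X = _]odd_double_half half// /= => h.
  have [ho hk] : odd (Num.truncn ((x : R) * 2 ^+ m.+1)) = s m /\
      Num.truncn (x * 2 ^+ m) = k m.
    move: h; case: (odd _); case: (s m) => /= h; split => //; lia.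
  move=> i; rewrite ltnS leq_eqVlt => /predU1P[->//|im].
  by apply: (IH.2 hk).
rewrite /leb /= /distribution /pushforward /uniform_prob integral_uniform_pdf.
have mcyl : measurable (binary_digits @^-1` cylinder n s : set (measurableTypeR R)).
  rewrite -[X in measurable X]setTI; apply: measurable_binary_digits => //.
  by apply: sub_sigma_algebra; exact: open_cylinder_set.
have mE := measurableI _ _ mcyl (measurable_itv `[0, 1]).
rewrite (eq_integral (fun=> 1%E)); last first.
  by move=> x /set_mem[_ /= ]; rewrite in_itv/= /uniform_pdf => ->; rewrite subr0 invr1.
rewrite integral_cst// mul1e.
have -> : binary_digits @^-1` cylinder n s `&` `[0, 1] =
    [set` `[(k n)%:R / 2 ^+ n, (k n).+1%:R / 2 ^+ n[] `|`
    (binary_digits @^-1` cylinder n s `&` [set 1 : R]).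
  have p0 : 0 < 2 ^+ n :> R by exact: exprn_gt0.
  apply/seteqP; split => x /=; rewrite !in_itv/=.
    move=> [cx /andP[x0]]; rewrite le_eqVlt => /predU1P[x1|x1]; first by right.
    left; have /dig[/(_ cx) tk _] : 0 <= x < 1 by rewrite x0.
    have := truncn_itv (mulr_ge0 x0 (ltW p0)).
    by rewrite tk ler_pdivrMr// ltr_pdivlMr.
  move=> [/andP[kx xk]|[cx x1]]; last by split=> //; rewrite x1 ler01 lexx.
  have x01 : 0 <= x < 1.
    rewrite (le_trans _ kx) ?divr_ge0// ?ltW//= (lt_le_trans xk)//.
    by rewrite ler_pdivrMr// mul1r -natrX ler_nat.
  have [x0 x1] := andP x01; split; last by rewrite x0 ltW.
  apply/(dig _ x01); apply: truncn_def.
  by rewrite -ler_pdivrMr// kx -ltr_pdivlMr.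
have m1 : measurable (binary_digits @^-1` cylinder n s `&` [set 1 : measurableTypeR R]).
  exact: measurableI.
rewrite measureU0//.
  apply: (eq_trans (lebesgue_measure_itv _)).
  rewrite /= lte_fin ltr_pM2r ?invr_gt0 ?exprn_gt0// ltr_nat.
  by rewrite ltnSn -EFinD -mulrBl -natrB// subSnn mul1r.
apply: (subset_measure0 m1 (measurable_set1 1)); first by move=> x [].
exact: lebesgue_measure_set1.
Qed.

(* Conditions are ordered as in Shelah's convention: p ≼ q means that q is
   stronger than p. *)
Record forcing := Forcing {
  cond :> Type;
  fle : cond -> cond -> Prop;
  fbot : cond;
  fle_refl : forall p, fle p p;
  fle_trans : forall p q r, fle p q -> fle q r -> fle p r;
  fbot_le : forall p, fle fbot p;
  fbot_uniq : forall p, fle p fbot -> p = fbot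
}.

Arguments fle {f} p q : rename.
Arguments fbot {f} : rename.
Notation "p ≼ q" := (fle p q) (at level 70, no associativity).

Section forcing_product.
Variables P Q : forcing.

Definition prod_fle (p q : P * Q) : Prop := p.1 ≼ q.1 /\ p.2 ≼ q.2.

Fact prod_fle_refl p : prod_fle p p.
Proof. by split; exact: fle_refl. Qed.

Fact prod_fle_trans p q r : prod_fle p q -> prod_fle q r -> prod_fle p r.
Proof. by move=> [a b] [c d]; split; [exact: fle_trans a c|exact: fle_trans b d]. Qed.

Fact prod_fbot_le p : prod_fle (fbot, fbot) p.
Proof. by split; exact: fbot_le. Qed.

Fact prod_fbot_uniq p : prod_fle p (fbot, fbot) -> p = (fbot, fbot).
Proof. by case: p => p q [/= /fbot_uniq -> /fbot_uniq ->]. Qed.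

Definition prod_forcing : forcing :=
  Forcing prod_fle_refl prod_fle_trans prod_fbot_le prod_fbot_uniq.

Definition fst_embedding (p : P) : prod_forcing := (p, fbot).

End forcing_product.

Section closed_sets_forcing.
Variables (R : realType) (a : \bar R).
Hypothesis a1 : (a < 1)%E.

Definition closed_above : Type :=
  {F : set cantor_space | closed F /\ (a < leb R F)%E}.

Definition closed_above_le (F G : closed_above) : Prop := sval G `<=` sval F.

Fact closed_aboveT : closed [set: cantor_space] /\ (a < leb R setT)%E.
Proof. by split; [exact: closedT|rewrite probability_setT]. Qed.

Definition closed_above_bot : closed_above := exist _ setT closed_aboveT.

Fact closed_above_refl F : closed_above_le F F.
Proof. by []. Qed.

Fact closed_above_trans F G H :
  closed_above_le F G -> closed_above_le G H -> closed_above_le F H.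
Proof. by move=> FG GH x /GH /FG. Qed.

Fact closed_above_bot_le F : closed_above_le closed_above_bot F.
Proof. by []. Qed.

Fact closed_above_bot_uniq F :
  closed_above_le F closed_above_bot -> F = closed_above_bot.
Proof.
case: F => F aF FT; apply: eq_exist; exact/seteqP.
Qed.

Definition closed_above_forcing : forcing :=
  Forcing closed_above_refl closed_above_trans
    closed_above_bot_le closed_above_bot_uniq.

End closed_sets_forcing.

Definition random_forcing (R : realType) : forcing :=
  closed_above_forcing (@lte01 R).

Fact half_lt1 (R : realType) : ((2^-1 : R)%:E < 1)%E.
Proof. by rewrite lte_fin invf_lt1// ltr1n. Qed.

Definition amoeba_forcing (R : realType) : forcing :=
  closed_above_forcing (@half_lt1 R).

(* A topology on T presented by a basis B. *)
Definition is_base {T : Type} (B : set (set T)) : Prop :=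
  \bigcup_(U in B) U = setT /\
  forall U V x, B U -> B V -> (U `&` V) x ->
    exists W, [/\ B W, W x & W `<=` U `&` V].

Definition base_nbhd {T : Type} (B : set (set T)) (x : T) (W : set T) : Prop :=
  exists U, [/\ B U, U x & U `<=` W].

Definition base_cvg {T : Type} (B : set (set T)) (x_ : nat -> T) (x : T) : Prop :=
  forall W, base_nbhd B x W -> \forall n \near \oo, W (x_ n).

Definition topologically_sweet (P : forcing) : Prop :=
  exists B : set (set P), [/\ countable B, is_base B,
    base_nbhd B fbot [set fbot] &
    forall (p_ : nat -> P) (p q : P) (W : set P),
      base_cvg B p_ p -> p ≼ q -> base_nbhd B q W ->
      exists r, [/\ W r, q ≼ r & infinite_set [set n | p_ n ≼ r]]].

(* BA(P) is the algebra of regular open subsets of P, for the topology whose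
   open sets are the upward closed ones; [ro_hull U] is the interior of the
   closure of U, and p is identified with the hull of its cone. *)
Definition ro_hull {P : forcing} (U : set P) : set P :=
  [set p | forall q, p ≼ q -> exists2 r, q ≼ r & U r].

Definition regular_open {P : forcing} (U : set P) : Prop := ro_hull U = U.

Definition BA_embed {P : forcing} (p : P) : set P := ro_hull [set q | p ≼ q].

Definition BA_compatible {P : forcing} (p q : P) : Prop :=
  exists U : set P, [/\ regular_open U, U !=set0,
    U `<=` BA_embed p & U `<=` BA_embed q].

Fact regular_open_BA_embed (P : forcing) (p : P) : regular_open (BA_embed p).
Proof.
apply/seteqP; split => q h r qr.
  have [s rs sp] := h _ qr; have [t st pt] := sp s (fle_refl s).
  by exists t => //; exact: fle_trans rs st.
by exists r; [exact: fle_refl|move=> s rs; apply: h; exact: fle_trans qr rs].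
Qed.

Fact BA_embed_anti (P : forcing) (p q : P) : p ≼ q -> BA_embed q `<=` BA_embed p.
Proof.
move=> pq r h s rs; have [t st qt] := h _ rs.
by exists t => //; exact: fle_trans pq qt.
Qed.

(* The forcing relation of Q for sentences about the elements and the subsets of
   ground model sets. A ground model set is a type X; its elements are denoted
   by themselves (check names), and a Q-name for a subset of X is a set of pairs
   (check x, c) with x in X and c in Q. Up to equality in the extension, these
   names denote all the subsets of X. A sentence is identified with the set of
   the conditions that force it. The connectives ¬, ∧ and ∀ are interpreted by
   the usual clauses, and the others are classical abbreviations; quantifiers
   range over all elements of a ground model set, or over all names for subsets
   of it. *)
Definition sentence (Q : forcing) : Type := Q -> Prop.

Definition name (Q : forcing) (X : Type) : Type := X -> Q -> Prop.

Section forcing_relation.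
Variable Q : forcing.
Implicit Types (q r s : Q) (phi psi : sentence Q).

(* an absolute statement about ground model objects *)
Definition fground (A : Prop) : sentence Q := fun=> A.

Definition fmem {X : Type} (x : X) (A : name Q X) : sentence Q := fun q =>
  forall r, q ≼ r -> exists2 s, r ≼ s & exists2 c, A x c & c ≼ s.

Definition fnot phi : sentence Q := fun q => forall r, q ≼ r -> ~ phi r.

Definition fand phi psi : sentence Q := fun q => phi q /\ psi q.

Definition fall {X : Type} (phi : X -> sentence Q) : sentence Q :=
  fun q => forall x, phi x q.

Definition fimp phi psi : sentence Q := fnot (fand phi (fnot psi)).

Definition fex {X : Type} (phi : X -> sentence Q) : sentence Q :=
  fnot (fall (fun x => fnot (phi x))).

Definition forces q phi : Prop := phi q.

Definition forced phi : Prop := forall q, forces q phi.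

(* the canonical name of the generic filter *)
Definition generic : name Q Q := fun r c => r = c.

End forcing_relation.

Arguments generic Q : clear implicits.

Declare Scope forcing_scope.
Delimit Scope forcing_scope with F.
Bind Scope forcing_scope with sentence.
Notation "« A »" := (@fground _ A%type) (at level 0, A at level 99) : forcing_scope.
Notation "x ∈ A" := (fmem x A) (at level 70, no associativity) : forcing_scope.
Notation "¬ A" := (fnot A) (at level 75, right associativity) : forcing_scope.
Notation "A ∧ B" := (fand A B) (at level 80, right associativity) : forcing_scope.
Notation "A ⇒ B" := (fimp A B)
  (at level 99, B at level 200, right associativity) : forcing_scope.
Notation "∀ x .. y , A" := (fall (fun x => .. (fall (fun y => A)) ..))
  (at level 10, x binder, y binder, A at level 200) : forcing_scope.
Notation "∃ x .. y , A" := (fex (fun x => .. (fex (fun y => A)) ..))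
  (at level 10, x binder, y binder, A at level 200) : forcing_scope.

(* The quotient (P : Q), where i : Q -> P presents Q as a subforcing of BA(P). *)
Definition quotient {P Q : forcing} (i : Q -> P) : name Q P := fun p q =>
  forces q (∀ r : Q, r ∈ generic Q ⇒ « BA_compatible p (i r) »)%F.

Lemma forces_quotient (P Q : forcing) (i : Q -> P) (p : P) (q : Q) :
  (forall r s : Q, r ≼ s -> i r ≼ i s) ->
  forces q (p ∈ quotient i)%F <-> forall r, q ≼ r -> BA_compatible p (i r).
Proof.
move=> i_mono; split=> [pq r qr|h r qr].
  have [s rs [c pc cs]] := pq _ qr.
  have sp : BA_compatible p (i s).
    apply: contrapT => nps; apply: (pc s s cs); split=> [t st|//].
    exists t; first exact: fle_refl.
    by exists s.
  have [U [oU U0 Up Us]] := sp; exists U; split=> //.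
  exact: (subset_trans Us (BA_embed_anti (i_mono _ _ rs))).
exists r; first exact: fle_refl.
exists r; last exact: fle_refl.
move=> s t rt [st npt]; have [u tu [_ <- su]] := st t (fle_refl t).
apply: (npt u tu) => /=.
have [U [oU U0 Up Us]] := h u (fle_trans qr (fle_trans rt tu)).
by exists U; split=> //; exact: (subset_trans Us (BA_embed_anti (i_mono _ _ su))).
Qed.

Section sweet_in_extension.
Variables P Q : forcing.
Local Open Scope forcing_scope.

Definition fsubset {X : Type} (A B : name Q X) : sentence Q :=
  ∀ x, x ∈ A ⇒ x ∈ B.

Definition fdense (D E : name Q P) : sentence Q :=
  fsubset D E ∧ ∀ p, p ∈ E ⇒ ∃ d, d ∈ D ∧ « p ≼ d ».

Definition fweakest (D : name Q P) (b : P) : sentence Q :=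
  b ∈ D ∧ ∀ p, p ∈ D ⇒ « b ≼ p » ∧ (« p ≼ b » ⇒ « p = b »).

(* A countable family of subsets of D is enumerated by a subset B of nat * P,
   its n-th member being {x | (n, x) ∈ B}. *)
Definition fbase (D : name Q P) (B : name Q (nat * P)) : sentence Q :=
  (∀ n x, (n, x) ∈ B ⇒ x ∈ D) ∧
  (∀ x, x ∈ D ⇒ ∃ n, (n, x) ∈ B) ∧
  (∀ m n x, (m, x) ∈ B ∧ (n, x) ∈ B ⇒
     ∃ k, (k, x) ∈ B ∧ ∀ y, (k, y) ∈ B ⇒ (m, y) ∈ B ∧ (n, y) ∈ B).

Definition fnbhd (D : name Q P) (B : name Q (nat * P)) (x : P) (W : name Q P) :
    sentence Q :=
  fsubset W D ∧ ∃ n, (n, x) ∈ B ∧ ∀ y, (n, y) ∈ B ⇒ y ∈ W.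

Definition fisolated (B : name Q (nat * P)) (x : P) : sentence Q :=
  ∃ n, (n, x) ∈ B ∧ ∀ y, (n, y) ∈ B ⇒ « y = x ».

(* S is (the graph of) a sequence of elements of D *)
Definition fsequence (D : name Q P) (S : name Q (nat * P)) : sentence Q :=
  (∀ n x, (n, x) ∈ S ⇒ x ∈ D) ∧
  (∀ n, ∃ x, (n, x) ∈ S) ∧
  (∀ n x y, (n, x) ∈ S ∧ (n, y) ∈ S ⇒ « x = y »).

Definition fcvg (D : name Q P) (B S : name Q (nat * P)) (p : P) : sentence Q :=
  ∀ W : name Q P, fnbhd D B p W ⇒
    ∃ N, ∀ n x, « (N <= n)%N » ∧ (n, x) ∈ S ⇒ x ∈ W.

Definition finfinitely_below (S : name Q (nat * P)) (r : P) : sentence Q :=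
  ∀ m, ∃ n x, « (m <= n)%N » ∧ (n, x) ∈ S ∧ « x ≼ r ».

Definition ftopologically_sweet (D : name Q P) : sentence Q :=
  ∃ b, fweakest D b ∧
  ∃ B : name Q (nat * P), fbase D B ∧ fisolated B b ∧
  ∀ (S : name Q (nat * P)) (p q : P) (W : name Q P),
    fsequence D S ∧ p ∈ D ∧ fcvg D B S p ∧ q ∈ D ∧ « p ≼ q » ∧ fnbhd D B q W ⇒
    ∃ r, r ∈ W ∧ « q ≼ r » ∧ finfinitely_below S r.

Definition no_dense_subforcing_sweet (E : name Q P) : sentence Q :=
  ∀ D : name Q P, fdense D E ⇒ ¬ ftopologically_sweet D.

End sweet_in_extension.

(* Main.v *)
(* Sweetness of R and A: take as basic open sets (besides the singleton of the
   weakest condition) {F <> bot : F included in C, rho < mu(F)}, with C an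
   intersection of finitely many clopen sets and rho rational. If F_n -> F then
   mu(F \ F_n) -> 0, so intersecting G included in F with a sparse enough
   subsequence of the F_n loses arbitrarily little measure of G.

   Failure in the quotient: let T_s (s in omega^<omega) be independent clopen
   sets of measure 4^-|s| and q_a the set of the points lying in no
   T_(a|(k+1)). Let D be a name for a dense subset and B = (B_j) a name for a
   base. In V choose, for every a in omega^omega, some d_a and c_a forcing
   d_a to be in D and above (2^omega, q_a). The Boolean values of "d_a in D" and
   of "d_a in B_j" live in a separable space, so by the Baire category theorem
   some a has, for every n, a neighbourhood in which the b with Boolean values
   4^-(n+1)-close to those of a are dense. Hence for each n there are
   L = 4^(h+1) such points b_(n,u), u < L, branching off from a at the same
   node, of length h = h(n). Let the generic real x choose one of them, with
   equal probabilities; an average over all the shifts of this choice makes the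
   resulting sequence d_(b_(n,u_n(x))) converge to d_a in V[x]. But a ground
   model closed set F of positive measure disjoint from T_s for all the s in a
   set Z of nodes satisfies sum_(s in Z) 4^-|s| <= 1/mu(F), so by the
   Borel-Cantelli lemma F is included in only finitely many of the
   q_(b_(n,u_n(x))). *)

Require Import Defs.
From mathcomp Require Import all_boot all_order all_algebra.
From mathcomp Require Import all_classical all_reals all_analysis.
From mathcomp Require Import lra ring zify.

Set Implicit Arguments.
Unset Strict Implicit.
Unset Printing Implicit Defensive.

Import Order.TTheory GRing.Theory Num.Theory.
Import numFieldNormedType.Exports.
Local Open Scope classical_set_scope.
Local Open Scope ring_scope.

(** * Fair-coin measure *)

Definition prob (R : realType) (A : set cantor_space) : R := fine (leb R A).

Lemma open_measurable_cantor (A : set cantor_space) :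
  open A -> measurable (A : set cantor_borel).
Proof. by move=> oA; exact: sub_sigma_algebra. Qed.

Lemma closed_measurable_cantor (A : set cantor_space) :
  closed A -> measurable (A : set cantor_borel).
Proof.
move=> /closed_openC/open_measurable_cantor/measurableC; rewrite setCK; exact.
Qed.

Lemma sum_half_le1 (R : realType) N : \sum_(n < N) 2 ^- n.+1 <= 1 :> R.
Proof.
have -> : \sum_(n < N) 2 ^- n.+1 = 1 - 2 ^- N :> R.
  elim: N => [|N IH]; first by rewrite big_ord0 expr0 invr1 subrr.
  by rewrite big_ord_recr/= IH exprS invfM; field.
by rewrite gerBl invr_ge0 exprn_ge0.
Qed.

Section measure.
Variable R : realType.
Implicit Types A B C : set cantor_space.
Local Notation m := (@prob R).
Local Notation meas A := (measurable (A : set cantor_borel)).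

Lemma lebE A : meas A -> leb R A = (m A)%:E.
Proof. by move=> mA; rewrite fineK// fin_num_measure. Qed.

Lemma prob_ge0 A : 0 <= m A.
Proof. by rewrite fine_ge0. Qed.

Lemma probT : m setT = 1.
Proof. by rewrite /prob probability_setT. Qed.

Lemma le_prob A B : meas A -> meas B -> A `<=` B -> m A <= m B.
Proof.
by move=> mA mB AB; rewrite -lee_fin -!lebE// le_measure// inE.
Qed.

Lemma prob_setD A B : meas A -> meas B -> m A = m (A `\` B) + m (A `&` B).
Proof.
move=> mA mB; apply: EFin_inj; rewrite EFinD -!lebE//.
- exact: measureDI.
- exact: measurableI.
- exact: measurableD.
Qed.

Lemma prob_setU_le A B : meas A -> meas B -> m (A `|` B) <= m A + m B.
Proof.
move=> mA mB; rewrite -lee_fin EFinD -!lebE//; first exact: measureU2.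
exact: measurableU.
Qed.

Lemma le_probD A B C : meas A -> meas B -> meas C ->
  m (A `\` C) <= m (A `\` B) + m (B `\` C).
Proof.
move=> mA mB mC; apply: le_trans (prob_setU_le (measurableD mA mB) (measurableD mB mC)).
apply: le_prob.
- exact: measurableD.
- by apply: measurableU; exact: measurableD.
- move=> z [Az nCz]; case: (pselect (B z)) => Bz; first by right.
  by left.
Qed.

Lemma prob_bigcup_le n (F : nat -> set cantor_space) (e : R) :
  (forall i, meas (F i)) -> (forall i, (i < n)%N -> m (F i) <= e) ->
  m (\bigcup_(i < n) F i) <= n%:R * e.
Proof.
move=> mF; elim: n => [|n IH] le_e; first by rewrite bigcup_mkord big_ord0 mul0r /prob measure0.
have mU k : meas (\bigcup_(i < k) F i) by exact: bigcup_measurable.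
rewrite -addn1 natrD mulrDl mul1r bigcup_mkord addn1 big_ord_recr/= -bigcup_mkord.
apply: (le_trans (prob_setU_le _ _)) => //; apply: lerD; last exact: le_e.
by apply: IH => i iltn; apply: le_e; exact: ltnW.
Qed.

Lemma prob_partition (I : finType) (f : cantor_space -> I) A :
  meas A -> (forall i, meas [set z | f z = i]) ->
  m A = \sum_i m (A `&` [set z | f z = i]).
Proof.
move=> mA mf.
suff H (l : seq I) : uniq l ->
    meas (A `&` [set z | f z \in l]) /\
    m (A `&` [set z | f z \in l]) = \sum_(i <- l) m (A `&` [set z | f z = i]).
  have [|_ <-] := H (index_enum I); first exact: index_enum_uniq.
  by congr (m _); apply/seteqP; split=> z; [split=> //=; rewrite mem_index_enum|case].
elim: l => [_|i l IH /= /andP[il ul]].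
  have -> : A `&` [set z | f z \in [::]] = set0 by apply/seteqP; split => z // [].
  by rewrite big_nil /prob measure0.
have [ml Sl] := IH ul.
have -> : A `&` [set z | f z \in i :: l] =
    (A `&` [set z | f z = i]) `|` (A `&` [set z | f z \in l]).
  apply/seteqP; split=> z /=; rewrite inE.
    by move=> [Az /predU1P[|]]; [left|right].
  by move=> [] [Az fz]; split => //; rewrite fz ?eqxx ?orbT.
split; first by apply: measurableU => //; exact: measurableI.
rewrite big_cons -Sl; apply: EFin_inj; rewrite EFinD -!lebE//.
- rewrite measureU//; first exact: measurableI.
  apply/seteqP; split=> z //= [[_ fzi] [_]].
  by rewrite fzi => /(negP il).
- exact: measurableI.
- by apply: measurableU => //; exact: measurableI.
Qed.

(** The limsup of the complements of the [G n] in [A] is null, so their tail unions have measure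
    tending to 0, eventually below [m A - b]. The threshold [b] keeps what remains a condition, for
    random forcing as for amoeba. *)
Lemma borel_cantelli_above A (G : nat -> set cantor_space) (b C : R) :
  meas A -> (forall n, meas (G n)) -> b < m A ->
  (forall N, \sum_(n < N) m (A `\` G n) <= C) ->
  exists N, b < m (A `&` \bigcap_(n in [set n | (N <= n)%N]) G n).
Proof.
move=> mA mG bA sumC.
pose F n : set cantor_borel := A `\` G n.
have mF n : measurable (F n) by exact: measurableD.
have sumF : (\sum_(n <oo) leb R (F n) < +oo)%E.
  apply: (@le_lt_trans _ _ C%:E); last exact: ltry.
  apply: lime_le; first exact: is_cvg_ereal_nneg_natsum_cond.
  apply: nearW => N; rewrite big_mkord.
  under eq_bigr do rewrite (lebE (mF _)).
  by rewrite sumEFin lee_fin.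
have cvgF : leb R (\bigcup_(k in [set k | (N <= k)%N]) F k) @[N --> \oo] --> 0%E.
  rewrite -(lim_sup_set_cvg0 mF sumF); apply: lim_sup_set_cvg => //.
  by rewrite -ge0_fin_numE// fin_num_measure//; exact: bigcup_measurable.
have nb : nbhs (0 : \bar R)%E [set x | (x < (m A - b)%:E)%E].
  by apply: open_nbhs_nbhs; split; [exact: open_ereal_lt_ereal|rewrite /= lte_fin subr_gt0].
have [N _ Nnb] := cvgF _ nb.
pose U := \bigcup_(k in [set k | (N <= k)%N]) F k.
have UAb : (leb R U < (m A - b)%:E)%E := Nnb N (leqnn N).
have mU : meas U by exact: bigcup_measurable.
exists N; set I := \bigcap_(n in _) _.
have mI : meas I by exact: bigcap_measurableType.
move: UAb; rewrite (lebE mU) lte_fin (prob_setD mA mI).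
suff : m (A `\` I) <= m U by lra.
apply: le_prob => //; first exact: measurableD.
move=> z [Az nIz]; apply: contrapT => nUz; apply: nIz => n /= Nn.
by apply: contrapT => nG; apply: nUz; exists n.
Qed.

End measure.

(** * Finitely determined sets *)

Definition res n (z : cantor_space) : {ffun 'I_n -> bool} := [ffun i => z (val i)].

(** Padding with [false] gives a section of [res n], hence a representative of each cylinder. *)
Definition ext n (s : {ffun 'I_n -> bool}) : cantor_space :=
  fun i => if insub i is Some j then s j else false.

Lemma res_ext n (s : {ffun 'I_n -> bool}) : res n (ext s) = s.
Proof. by apply/ffunP => i; rewrite ffunE /ext valK. Qed.

Lemma res_eqP n (z y : cantor_space) :
  res n z = res n y <-> forall i, (i < n)%N -> z i = y i.
Proof.
split=> [zy i ilt|zy]; last by apply/ffunP => i; rewrite !ffunE zy//; exact: ltn_ord.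
by have /ffunP/(_ (Ordinal ilt)) := zy; rewrite !ffunE.
Qed.

Lemma fiber_res n (s : {ffun 'I_n -> bool}) :
  [set z | res n z = s] = cylinder n (ext s).
Proof.
apply/seteqP; split=> z zs; first by apply/res_eqP; rewrite res_ext.
by rewrite /= -(res_ext s); apply/res_eqP.
Qed.

Lemma open_res n (P : {ffun 'I_n -> bool} -> Prop) : open [set z | P (res n z)].
Proof.
rewrite (_ : [set z | _] = \bigcup_(s in P) [set z | res n z = s]).
  by apply: bigcup_open => s _; rewrite fiber_res; exact: open_cylinder_set.
by apply/seteqP; split=> [z Pz|z [s Ps /= ->//]]; exists (res n z).
Qed.

Lemma closed_res n (P : {ffun 'I_n -> bool} -> Prop) : closed [set z | P (res n z)].
Proof.
by rewrite -openC; exact: (open_res (fun s => ~ P s)).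
Qed.

Definition determined n (A : set cantor_space) :=
  forall z y, res n z = res n y -> A z -> A y.

Lemma determined_leq n k A : (n <= k)%N -> determined n A -> determined k A.
Proof.
move=> nk dA z y /res_eqP zy; apply: dA; apply/res_eqP => i ilt.
by apply: zy; exact: leq_trans nk.
Qed.

Lemma determinedE n A : determined n A -> A = [set z | A (ext (res n z))].
Proof.
by move=> dA; apply/seteqP; split=> z /=; apply: dA; rewrite res_ext.
Qed.

Lemma determined_open n A : determined n A -> open A.
Proof. by move=> /determinedE ->; exact: (@open_res n (fun s => A (ext s))). Qed.

Lemma determinedC n A : determined n A -> determined n (~` A).
Proof. by move=> dA z y zy nAz Ay; apply: nAz; apply: dA Ay. Qed.

Lemma determinedI n A B : determined n A -> determined n B -> determined n (A `&` B).
Proof. by move=> dA dB z y zy [Az Bz]; split; [exact: dA Az|exact: dB Bz]. Qed.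

Definition flip (k : nat) (z : cantor_space) : cantor_space :=
  fun i => z i (+) (i == k).

Section cantor_measure.
Variable R : realType.
Implicit Types A B C : set cantor_space.
Local Notation m := (@prob R).
Local Notation meas A := (measurable (A : set cantor_borel)).

Lemma prob_res n (P : pred {ffun 'I_n -> bool}) :
  m [set z | P (res n z)] = #|P|%:R * 2 ^- n.
Proof.
have mo (Q : {ffun 'I_n -> bool} -> Prop) : meas [set z | Q (res n z)].
  by apply: open_measurable_cantor; exact: open_res.
rewrite (prob_partition R (mo P) (fun i => mo (fun s => s = i))).
transitivity (\sum_(s | P s) 2 ^- n : R); last by rewrite sumr_const mulr_natl.
rewrite [RHS]big_mkcond/=; apply: eq_bigr => s _; case: ifP => Ps.
  rewrite (_ : _ `&` _ = [set z | res n z = s]).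
    by rewrite fiber_res /prob leb_cylinder.
  by apply/seteqP; split=> z /= [] // ->.
rewrite (_ : _ `&` _ = set0); first by rewrite /prob measure0.
by apply/seteqP; split=> z //= [+ zs]; rewrite zs Ps.
Qed.

(** Flipping bit [k] exchanges the two halves of [A]; at a level [N > k] this becomes a count of bit
    strings. *)
Lemma prob_half n k A : determined n A -> (forall z, A z -> A (flip k z)) ->
  m (A `&` [set z | z k = false]) = m A / 2.
Proof.
move=> /(determined_leq (leq_maxl n k.+1)); set N := maxn _ _ => dA Af.
have kN : (k < N)%N by exact: leq_maxr.
pose P : pred {ffun 'I_N -> bool} := fun s => `[< A (ext s) >].
pose f (s : {ffun 'I_N -> bool}) : {ffun 'I_N -> bool} := [ffun i => s i (+) (val i == k)].
have fK : involutive f.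
  by move=> s; apply/ffunP => i; rewrite !ffunE -addbA addbb addbF.
have Pf s : P (f s) = P s.
  suff H s' : P s' -> P (f s') by apply/idP/idP; [move=> /H; rewrite fK|exact: H].
  move=> /asboolP/Af As; apply/asboolP; apply: dA As; apply/ffunP => i.
  by rewrite res_ext !ffunE /flip -[in RHS](res_ext s') ffunE.
rewrite [in RHS](determinedE dA).
have -> : [set z | A (ext (res N z))] = [set z | P (res N z)].
  by apply/seteqP; split=> z /= /asboolP.
have -> : A `&` [set z | z k = false] =
    [set z | [predI P & [pred s : {ffun 'I_N -> bool} | ~~ s (Ordinal kN)]] (res N z)].
  have resk z : res N z (Ordinal kN) = z k by rewrite ffunE.
  apply/seteqP; split=> z /=; rewrite inE/= resk.
    move=> [Az ->]; rewrite andbT; apply/asboolP; apply: dA Az.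
    by rewrite res_ext.
  by move=> /andP[/asboolP As /negbTE]; split=> //; apply: dA As; rewrite res_ext.
rewrite !prob_res.
(* The involution [f] maps the strings of [P] with bit [k] false onto those with bit [k] true. *)
have -> : #|P| = (#|[predI P & [pred s : {ffun 'I_N -> bool} | ~~ s (Ordinal kN)]]|).*2.
  rewrite -addnn -[LHS](cardID [pred s : {ffun 'I_N -> bool} | s (Ordinal kN)]) addnC; congr addn.
    by apply: eq_card => s; rewrite !inE andbC.
  rewrite -[RHS](fintype.card_image (inv_inj fK)); apply: eq_card => s.
  rewrite -[in RHS](fK s) fintype.mem_image; last exact: inv_inj.
  by rewrite !inE ![in RHS]/in_mem/= Pf ffunE eqxx addbT negbK.
by rewrite -muln2 natrM; field.
Qed.

End cantor_measure.

(** * Outer approximation of closed sets by clopen sets *)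

Section closed_approximation.
Variable R : realType.
Local Notation m := (@prob R).
Local Notation meas A := (measurable (A : set cantor_borel)).

(** The unions [C n] of the level [n] cylinders meeting [K] decrease to [K], since a point outside
    the closed set [K] has a cylinder missing [K]; continuity from above concludes. *)
Lemma prob_closed_approx (K : set cantor_space) (e : R) : closed K -> 0 < e ->
  exists n (S : {set {ffun 'I_n -> bool}}),
    K `<=` [set z | res n z \in S] /\ m ([set z | res n z \in S] `\` K) < e.
Proof.
move=> cK e0; have mK := closed_measurable_cantor cK.
pose C n : set cantor_borel := [set z | exists2 y, K y & res n y = res n z].
have mC n : meas (C n).
  apply: open_measurable_cantor.
  exact: (@open_res n (fun s => exists2 y, K y & res n y = s)).
have capC : \bigcap_n C n = K.
  apply/seteqP; split=> [z Cz|z Kz n _]; last by exists z.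
  apply: contrapT => nKz.
  have [n nK] := open_cylinder (closed_openC cK) nKz.
  have [y Ky /res_eqP yz] := Cz n I.
  by apply: (nK y) => // i ilt; exact: yz.
have cvgC : leb R (C n) @[n --> \oo] --> leb R K.
  rewrite -capC; apply: nonincreasing_cvg_mu => //.
  - by rewrite -ge0_fin_numE// fin_num_measure.
  - by rewrite capC.
  - move=> i j ij; apply/subsetPset => z [y Ky yz]; exists y => //.
    move: yz => /res_eqP yz; apply/res_eqP => k ki; apply: yz; exact: leq_trans ij.
have nb : nbhs (leb R K) [set x | (x < (m K + e)%:E)%E].
  apply: open_nbhs_nbhs; split; first exact: open_ereal_lt_ereal.
  by rewrite /mkset lebE// lte_fin ltrDl.
have [n _ Nn] := cvgC _ nb.
have : (leb R (C n) < (m K + e)%:E)%E := Nn n (leqnn n).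
rewrite lebE// lte_fin => Cn.
pose S := finset (fun s : {ffun 'I_n -> bool} => `[< exists2 y, K y & res n y = s >]).
exists n, S; have -> : [set z | res n z \in S] = C n.
  by apply/seteqP; split=> z /=; rewrite inE => /asboolP.
split; first by move=> z Kz; exists z.
have := prob_setD R (mC n) mK.
rewrite (_ : C n `&` K = K); first by move: Cn; lra.
by apply/seteqP; split=> [z []//|z Kz]; split=> //; exists z.
Qed.

End closed_approximation.

(** * Independent sets indexed by the nodes of a tree *)

(* The sets [node_set s], for s in omega^<omega, are independent of measure
   4^-|s|: they are given by pairwise disjoint blocks of coordinates. *)
Definition coordinate (s : seq nat) (i : nat) : nat := pickle (s, i).

Definition node_set (s : seq nat) : set cantor_space :=
  [set z | forall i, (i < (size s).*2)%N -> z (coordinate s i) = false].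

(** Starting at length [k.+1] skips the empty node, whose [node_set] is the whole space. *)
Definition branch_set (a : nat -> nat) : set cantor_space :=
  [set z | forall k, ~ node_set (mkseq a k.+1) z].

Lemma coordinate_inj s t i j : coordinate s i = coordinate t j -> s = t /\ i = j.
Proof. by move=> /(pcan_inj pickleK)[]. Qed.

Lemma flip_other k j z : j != k -> flip k z j = z j.
Proof. by rewrite /flip => /negbTE ->; rewrite addbF. Qed.

Section node_sets.
Variable R : realType.
Local Notation m := (@prob R).

(** Since [A] is invariant under flips in the block of [s], each bit prescribed there halves the
    measure: [A] is independent of that block. *)
Lemma prob_coordinates n A s j : determined n A ->
  (forall i z, A z -> A (flip (coordinate s i) z)) ->
  m (A `&` [set z | forall i, (i < j)%N -> z (coordinate s i) = false]) = m A * 2 ^- j.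
Proof.
move=> dA Af; elim: j => [|j IH].
  rewrite expr0 invr1 mulr1; congr (m _).
  by apply/seteqP; split=> [z []|z Az].
pose B j := A `&` [set z | forall i, (i < j)%N -> z (coordinate s i) = false].
have dB : determined (maxn n (\max_(i < j) (coordinate s i).+1)) (B j).
  move=> z y /res_eqP zy [Az zj]; split.
    apply: dA Az; apply/res_eqP => i ilt; apply: zy.
    by rewrite leq_max ilt.
  move=> i ij; rewrite -(zj i ij); apply/esym/zy; rewrite leq_max.
  by rewrite (leq_bigmax (F := fun i : 'I_j => (coordinate s i).+1) (Ordinal ij)) orbT.
rewrite exprSr invfM mulrA -IH -(@prob_half R _ (coordinate s j) _ dB).
  congr (m _); apply/seteqP; split=> z /=.
    move=> [Az zj]; split; last exact: zj.
    by split=> // i ij; apply: zj; exact: ltnW.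
  move=> [[Az zj] zsj]; split=> // i; rewrite ltnS leq_eqVlt => /predU1P[->//|].
  exact: zj.
move=> z [Az zj]; split; first exact: Af.
move=> i ij /=; rewrite flip_other; first exact: zj.
by apply/eqP => /coordinate_inj[_ E]; move: ij; rewrite E ltnn.
Qed.

Lemma node_set_determined s : exists n, determined n (node_set s).
Proof.
exists (\max_(i < (size s).*2) (coordinate s i).+1) => z y /res_eqP zy zs i ilt.
rewrite -(zs i ilt); apply/esym/zy.
exact: (leq_bigmax (F := fun i : 'I_(size s).*2 => (coordinate s i).+1) (Ordinal ilt)).
Qed.

Lemma open_node_set s : open (node_set s).
Proof. by have [n] := node_set_determined s; exact: determined_open. Qed.

Lemma expr_double_four n : 2 ^- n.*2 = 4 ^- n :> R.
Proof. by rewrite -mul2n exprM; congr (_ ^- n); rewrite expr2; lra. Qed.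

Lemma prob_node_set s : m (node_set s) = 4 ^- size s.
Proof.
have dT : determined 0 setT by [].
rewrite -[node_set s]setTI /node_set (prob_coordinates _ dT)// probT mul1r.
by rewrite expr_double_four.
Qed.

Definition avoid (l : seq (seq nat)) : set cantor_space :=
  [set z | forall s, s \in l -> ~ node_set s z].

Lemma avoid_determined l : exists n, determined n (avoid l).
Proof.
elim: l => [|s l [n IH]]; first by exists 0%N.
have [k dk] := node_set_determined s.
exists (maxn k n).
have -> : avoid (s :: l) = ~` node_set s `&` avoid l.
  apply/seteqP; split=> z /=.
    by move=> h; split=> [|t tl]; apply: h; rewrite inE ?eqxx// tl orbT.
  by move=> [h1 h2] t; rewrite inE => /predU1P[->//|]; exact: h2.
apply: determinedI; last exact: determined_leq (leq_maxr _ _) IH.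
apply: determinedC; exact: determined_leq (leq_maxl _ _) dk.
Qed.

(** A node outside [l] has a block of coordinates on which [avoid l] does not depend. *)
Lemma prob_avoid_cons s l : s \notin l ->
  m (avoid (s :: l)) = m (avoid l) * (1 - 4 ^- size s).
Proof.
move=> sl; have [n dl] := avoid_determined l.
have mA : measurable (avoid l : set cantor_borel).
  exact: open_measurable_cantor (determined_open dl).
have mN : measurable (node_set s : set cantor_borel).
  exact: open_measurable_cantor (open_node_set s).
have := prob_setD R mA mN.
have -> : m (avoid l `&` node_set s) = m (avoid l) * 4 ^- size s.
  rewrite (prob_coordinates _ dl); first by rewrite expr_double_four.
  move=> i z Az t tl /= nt; apply: (Az t tl) => j jlt.
  rewrite -(nt j jlt) flip_other//; apply/eqP => /coordinate_inj[ts _].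
  by move: sl; rewrite -ts tl.
have -> : avoid (s :: l) = avoid l `\` node_set s.
  apply/seteqP; split=> z /=.
    by move=> h; split=> [t tl|]; apply: h; rewrite inE ?eqxx// tl orbT.
  by move=> [h1 h2] t; rewrite inE => /predU1P[->//|]; exact: h1.
by lra.
Qed.

(** With [x = 4 ^- size s], the induction rests on [(1 - x) * (1 + x + S) <= 1 + S]. A set of
    positive measure that misses all these node sets thus bounds the sum. *)
Lemma prob_avoid l : uniq l ->
  m (avoid l) * (1 + \sum_(s <- l) 4 ^- size s) <= 1.
Proof.
elim: l => [_|s l IH /= /andP[sl ul]].
  rewrite big_nil addr0 mulr1 (_ : avoid [::] = setT) ?probT//.
  by apply/seteqP; split.
rewrite big_cons prob_avoid_cons//.
apply: le_trans (IH ul); rewrite -mulrA ler_wpM2l ?prob_ge0//.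
set x := 4 ^- size s; set S := \sum_(_ <- _) _.
have x0 : 0 <= x by rewrite invr_ge0 exprn_ge0.
have S0 : 0 <= S by apply: sumr_ge0 => t _; rewrite invr_ge0 exprn_ge0.
by nra.
Qed.

Lemma closed_branch_set a : closed (branch_set a).
Proof.
rewrite (_ : branch_set a = \bigcap_k ~` node_set (mkseq a k.+1)).
  by apply: closed_bigI => k _; apply: open_closedC; exact: open_node_set.
by apply/seteqP; split=> z /= h k; [move=> _|]; exact: h.
Qed.

(** The removed node sets have total measure at most the sum of the [4 ^- k.+1], that is 1/3; more
    than 1/2 remains, as amoeba requires. *)
Lemma prob_branch_set a : 2^-1 < m (branch_set a).
Proof.
pose N k : set cantor_borel := node_set (mkseq a k.+1).
have mN k : measurable (N k) by exact: open_measurable_cantor (open_node_set _).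
have mq := closed_measurable_cantor (@closed_branch_set a).
have := prob_setD R (measurableT : measurable (setT : set cantor_borel)) mq.
rewrite setTI probT.
suff : m (setT `\` branch_set a) <= 3^-1 by lra.
have -> : setT `\` branch_set a = \bigcup_k N k.
  apply/seteqP; split=> z /=.
    by move=> [_ /existsNP[k /contrapT nk]]; exists k.
  by move=> [k _ nk]; split=> // /(_ k).
have mU : measurable (\bigcup_k N k) by exact: bigcup_measurable.
rewrite -lee_fin -(lebE R mU).
apply: (le_trans (measure_sigma_subadditive (leb R) mN mU (@subset_refl _ _))).
apply: lime_le; first exact: is_cvg_ereal_nneg_natsum_cond.
apply: nearW => n; rewrite big_mkord.
rewrite (eq_bigr (fun i : 'I_n => (4 ^- i.+1)%:E)); last first.
  by move=> i _; apply: etrans (lebE R (mN i)) _; rewrite prob_node_set size_mkseq.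
rewrite sumEFin lee_fin.
have -> : \sum_(i < n) 4 ^- i.+1 = (1 - 4 ^- n) / 3 :> R.
  elim: n => [|n IH]; first by rewrite big_ord0 expr0 invr1 subrr mul0r.
  by rewrite big_ord_recr/= IH exprS invfM; field.
have : 0 <= 4 ^- n :> R by rewrite invr_ge0 exprn_ge0.
by lra.
Qed.

End node_sets.

(** * Sweetness of the ground model forcings *)

Lemma countable_image T U (f : T -> U) (A : set T) : countable A -> countable (f @` A).
Proof. by move=> cA; apply: (sub_countable (card_image_le f A)). Qed.

Lemma unbounded_infinite (A : set nat) :
  (forall m, exists2 n, (m <= n)%N & A n) -> infinite_set A.
Proof.
move=> unb /finite_seqP[s As].
have [n + An] := unb (\max_(i <- s) i).+1.
have ns : n \in s by move: An; rewrite As.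
by rewrite ltnNge (@leq_bigmax_seq _ s xpredT (fun i => i) n).
Qed.

Lemma infinite_unbounded (A : set nat) : infinite_set A ->
  forall m, exists2 n, (m <= n)%N & A n.
Proof.
move=> iA m; apply: contrapT => nm; apply: iA.
apply: sub_finite_set (finite_II m) => n An /=.
by rewrite ltnNge; apply/negP => mn; apply: nm; exists n.
Qed.

(** Sweetness of [P] gives [r1] above infinitely many first coordinates; sweetness of [Q] is then
    applied along that subsequence. *)
Lemma topologically_sweet_prod (P Q : forcing) :
  topologically_sweet P -> topologically_sweet Q -> topologically_sweet (prod_forcing P Q).
Proof.
move=> [B [cB [BT BI] B0 sB]] [C [cC [CT CI] C0 sC]].
pose D : set (set (prod_forcing P Q)) := (fun UV => UV.1 `*` UV.2) @` (B `*` C).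
have DX U V : B U -> C V -> D (U `*` V) by move=> BU CV; exists (U, V).
have nbX x W : base_nbhd D x W -> exists U V, [/\ B U, C V, U x.1, V x.2 & U `*` V `<=` W].
  by move=> [_ [[[U V] [/= BU CV] <-] [/= Ux Vx] UVW]]; exists U, V.
have Bx x : exists2 U, B U & U x by have : setT x by []; rewrite -BT => -[U]; exists U.
have Cx x : exists2 U, C U & U x by have : setT x by []; rewrite -CT => -[U]; exists U.
exists D; split.
- by apply: countable_image; exact: countableX.
- split.
    apply/seteqP; split=> // -[x y] _.
    have [U BU Ux] := Bx x; have [V CV Vy] := Cx y.
    by exists (U `*` V); [exact: DX|].
  move=> _ _ [x y] [[U V] [/= BU CV] <-] [[U' V'] [/= BU' CV'] <-] [[/= Ux Vy] [/= U'x V'y]].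
  have [U2 [BU2 U2x sU2]] := BI U U' x BU BU' (conj Ux U'x).
  have [V2 [CV2 V2y sV2]] := CI V V' y CV CV' (conj Vy V'y).
  exists (U2 `*` V2); split=> //; first exact: DX.
  by move=> [u v] [/= /sU2[uU uU'] /sV2[vV vV']].
- have [U [BU U0 sU]] := B0; have [V [CV V0 sV]] := C0.
  exists (U `*` V); split=> //; first exact: DX.
  by move=> [u v] [/= /sU /= -> /sV /= ->].
move=> p_ p q W cvg [pq1 pq2] /nbX[U [V [BU CV Uq Vq UVW]]].
have cvg1 : base_cvg B (fun n => (p_ n).1) p.1.
  move=> W1 [U1 [BU1 U1p sU1]]; have [V1 CV1 V1p] := Cx p.2.
  have := cvg (U1 `*` V1); case; first by exists (U1 `*` V1); split=> //; exact: DX.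
  by move=> N _ h; exists N => // n /h[/= /sU1].
have [r1 [Ur1 qr1 inf1]] := sB _ _ _ U cvg1 pq1 (ex_intro _ U (And3 BU Uq (@subset_refl _ _))).
(* [f] need not be increasing: [k <= f k] suffices for convergence along [f] and for infinitely many
   indices. *)
have /choice[f fP] : forall k, exists n, (k <= n)%N /\ (p_ n).1 ≼ r1.
  by move=> k; have [n kn rn] := infinite_unbounded inf1 k; exists n.
have cvg2 : base_cvg C (fun k => (p_ (f k)).2) p.2.
  move=> W1 [V1 [CV1 V1p sV1]]; have [U1 BU1 U1p] := Bx p.1.
  have := cvg (U1 `*` V1); case; first by exists (U1 `*` V1); split=> //; exact: DX.
  move=> N _ h; exists N => // k /= Nk.
  by have [_ /sV1] := h (f k) (leq_trans Nk (fP k).1).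
have [r2 [Vr2 qr2 inf2]] := sC _ _ _ V cvg2 pq2 (ex_intro _ V (And3 CV Vq (@subset_refl _ _))).
exists (r1, r2); split; [exact: UVW|by split|].
apply: unbounded_infinite => m; have [k mk rk] := infinite_unbounded inf2 m.
exists (f k); first exact: leq_trans mk (fP k).1.
by split=> //; exact: (fP k).2.
Qed.

(** [x] will be the threshold of the forcing, possibly [-oo], and [rho] that of a basic open set;
    one real [b] serves for both. *)
Lemma real_above (R : realType) (x : \bar R) (rho y : R) :
  rho < y -> (x < y%:E)%E -> exists b, [/\ b < y, rho <= b & (x <= b%:E)%E].
Proof.
move=> rhoy; case: x => [x||]; last first.
- by move=> _; exists rho; split=> //; exact: leNye.
- by rewrite ltNge leey.
rewrite lte_fin => xy; exists (Num.max rho x); split.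
- by rewrite gt_max rhoy xy.
- by rewrite le_max lexx.
- by rewrite lee_fin le_max lexx orbT.
Qed.

Section closed_above_sweet.
Variables (R : realType) (a : \bar R).
Hypothesis a1 : (a < 1)%E.
Local Notation m := (@prob R).
Local Notation Q := (closed_above_forcing a1).

(** A countable type of codes: it makes the base countable, and finite lists of codes can be
    pickled. *)
Definition clopen_code : Type := {n & {set {ffun 'I_n -> bool}}}.

Definition clopen_set (c : clopen_code) : set cantor_space :=
  [set z | res (tag c) z \in tagged c].

Definition sweet_basic (c : seq {n & {set {ffun 'I_n -> bool}}} * rat) : set Q :=
  [set F : Q | [/\ F <> fbot, forall d, d \in c.1 -> sval F `<=` clopen_set d
    & ratr c.2 < m (sval F)]].

(** [None] contributes the singleton of the weakest condition, which makes it isolated. *)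
Definition sweet_base : set (set Q) := range (oapp sweet_basic [set fbot]).

Lemma closed_cond (F : Q) : closed (sval F).
Proof. by case: F => F []. Qed.

Lemma above_cond (F : Q) : (a < (m (sval F))%:E)%E.
Proof. by case: F => F [cF aF] /=; rewrite -lebE//; exact: closed_measurable_cantor. Qed.

(** Take a clopen superset of [p] with excess below [e / 2]. Eventually [p_ n] lies inside it and
    has measure above [m (sval p) - e / 2], so it misses less than [e] of it. *)
Lemma sweet_base_cvg (p_ : nat -> Q) (p : Q) (e : R) :
  base_cvg sweet_base p_ p -> 0 < e ->
  \forall n \near \oo, m (sval p `\` sval (p_ n)) < e.
Proof.
move=> cvg e0; have mcond (F : Q) := closed_measurable_cantor (@closed_cond F).
have [p0|p0] := pselect (p = fbot).
  have [|N _ Np] := cvg [set fbot].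
    by exists [set fbot]; split=> //; exists None.
  exists N => // n /Np /= ->; rewrite p0.
  by rewrite setDT /prob measure0.
have e2 : 0 < e / 2 by rewrite divr_gt0.
have [n [S [pS mS]]] := prob_closed_approx (@closed_cond p) e2.
have : m (sval p) - e / 2 < m (sval p) by rewrite ltrBlDr ltrDl.
move=> /rat_in_itvoo[rho]; rewrite in_itv/= => /andP[rho1 rho2].
pose c : {n & {set {ffun 'I_n -> bool}}} := existT _ n S.
have [|N _ Np] := cvg (sweet_basic ([:: c], rho)).
  exists (sweet_basic ([:: c], rho)); split=> //; first by exists (Some ([:: c], rho)).
  by split=> // d; rewrite inE => /eqP ->.
exists N => // k /Np[_ /(_ c)]; rewrite inE eqxx => /(_ isT) pkS /= rhok.
have mC : measurable (clopen_set c : set cantor_borel).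
  exact: open_measurable_cantor (@open_res n (fun s => s \in S)).
have := prob_setD R mC (mcond p).
have := prob_setD R mC (mcond (p_ k)).
have -> : clopen_set c `&` sval p = sval p by apply/setIidPr.
have -> : clopen_set c `&` sval (p_ k) = sval (p_ k) by apply/setIidPr.
have : m (sval p `\` sval (p_ k)) <= m (clopen_set c `\` sval (p_ k)).
  apply: le_prob; [exact: measurableD|exact: measurableD|exact: setSD].
by move: mS; rewrite -/(clopen_set c); lra.
Qed.

Lemma closed_above_sweet : topologically_sweet Q.
Proof.
have mcond (F : Q) := closed_measurable_cantor (@closed_cond F).
exists sweet_base; split.
- by apply: countable_image; exact: countableP.
- split.
    apply/seteqP; split=> // F _.
    have [->|F0] := pselect (F = fbot); first by exists [set fbot]; [exists None|].
    (* The bound -1 is below every measure, so this set contains all conditions but [fbot]. *)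
    exists (sweet_basic ([::], -1)); first by exists (Some ([::], -1)).
    by split=> //=; rewrite rmorphN1; apply: lt_le_trans (prob_ge0 R _); rewrite ltrN10.
  move=> U V F; have [-> SU SV [UF VF]|F0] := pselect (F = fbot).
    exists [set fbot]; split=> //; first by exists None.
    by move=> _ ->.
  move=> [[[l rho]|] _ <-]; last by move=> _ [].
  move=> [[[l' rho']|] _ <-]; last by move=> [_].
  move=> [[_ lF rhoF] [_ lF' rhoF']].
  have key : ratr (Num.max rho rho') < m (sval F).
    by rewrite /Num.max; case: ifP.
  exists (sweet_basic (l ++ l', Num.max rho rho')); split.
  + by exists (Some (l ++ l', Num.max rho rho')).
  + by split=> // d; rewrite mem_cat => /orP[/lF|/lF'].
  move=> G [G0 lG rhoG]; split; split=> //.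
  + by move=> d dl; apply: lG; rewrite mem_cat dl.
  + by apply: le_lt_trans rhoG; rewrite ler_rat le_max lexx.
  + by move=> d dl; apply: lG; rewrite mem_cat dl orbT.
  + by apply: le_lt_trans rhoG; rewrite ler_rat le_max lexx orbT.
- by exists [set fbot]; split=> //; exists None.
move=> p_ p q W cvg pq [U [SU Uq UW]].
(* If [p] is the isolated point [fbot], the sequence is eventually [fbot], which lies below [q]. *)
have [p0|p0] := pselect (p = fbot).
  exists q; split; [exact: UW|exact: fle_refl|].
  have [|N _ Np] := cvg [set fbot].
    by exists [set fbot]; split=> //; exists None.
  apply: unbounded_infinite => k; exists (maxn k N); first exact: leq_maxl.
  rewrite /mkset; have -> : p_ (maxn k N) = fbot := Np _ (leq_maxr _ _).
  exact: fbot_le.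
have q0 : q <> fbot.
  by move=> q0; apply: p0; apply: fbot_uniq; rewrite -q0.
(* A closed subset of [q] of measure above [b] is a condition, by [a <= b], and stays in [U]. *)
have [b [bq ab bU]] : exists b, [/\ b < m (sval q), (a <= b%:E)%E &
    forall r : Q, q ≼ r -> b < m (sval r) -> U r].
  have aq := above_cond q.
  case: SU Uq => -[[l rho]|] _ <- //= [_ lq rhoq].
  have [b [bq rhob ab]] := real_above rhoq aq; exists b; split=> // r qr br; split.
  - by move=> r0; apply: q0; apply: fbot_uniq; rewrite -r0.
  - by move=> d /lq; apply: subset_trans.
  - exact: le_lt_trans br.
have /choice[f fP] : forall k, exists n, (k <= n)%N /\ m (sval p `\` sval (p_ n)) < 2 ^- k.+1.
  move=> k; have e0 : 0 < 2 ^- k.+1 :> R by rewrite invr_gt0 exprn_gt0.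
  have [N _ Np] := sweet_base_cvg cvg e0.
  by exists (maxn k N); split; [exact: leq_maxl|apply: Np; exact: leq_maxr].
have [|N bN] := @borel_cantelli_above R (sval q) (fun k => sval (p_ (f k))) b 1
    (mcond q) (fun k => mcond (p_ (f k))) bq.
  move=> N; apply: le_trans (sum_half_le1 R N).
  apply: ler_sum => k _; apply/ltW; apply: le_lt_trans (fP k).2.
  by apply: le_prob; [exact: measurableD|exact: measurableD|exact: setSD].
pose G := sval q `&` \bigcap_(n in [set n | (N <= n)%N]) sval (p_ (f n)).
have cG : closed G.
  by apply: closedI; [exact: closed_cond|apply: closed_bigI => k _; exact: closed_cond].
have aG : (a < leb R G)%E.
  rewrite lebE; last exact: closed_measurable_cantor.
  by apply: le_lt_trans ab _; rewrite lte_fin.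
pose r : Q := exist _ G (conj cG aG).
have qr : q ≼ r by move=> z [].
exists r; split=> //; first by apply: UW; exact: bU.
apply: unbounded_infinite => k; exists (f (maxn k N)).
  by apply: leq_trans (fP (maxn k N)).1; exact: leq_maxl.
by move=> z [_ /(_ (maxn k N))]; apply; exact: leq_maxr.
Qed.

End closed_above_sweet.

(** * A category argument *)

(* The points [a] without this property form a meager set. *)
Lemma baire_dense_pieces (tau : nat -> (nat -> nat) -> nat) :
  exists a, forall n, exists M, forall t, prefix (mkseq a M) t ->
    exists2 b, mkseq b (size t) = t & tau n b = tau n a.
Proof.
pose thru (s : seq nat) b := mkseq b (size s) = s.
have thru_prefix t t' b : prefix t t' -> thru t' b -> thru t b.
  move=> /prefixP[u ->]; rewrite /thru size_cat /mkseq iotaD map_cat.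
  by move=> /(congr1 (take (size t))); rewrite !take_size_cat// size_map size_iota.
(* Either some extension of [s] excludes the value [k] of [tau n], or the points with this value are
   dense above [s]. Appending 0 forces the length to grow. *)
have step (nks : nat * nat * seq nat) : exists s', [/\ prefix nks.2 s',
    (size nks.2 < size s')%N &
    (forall b, thru s' b -> tau nks.1.1 b <> nks.1.2) \/
    (forall t, prefix s' t -> exists2 b, thru t b & tau nks.1.1 b = nks.1.2)].
  case: nks => [[n k] s] /=.
  have [[t [st nt]]|ns] := pselect (exists t, prefix s t /\
      forall b, thru t b -> tau n b <> k).
    exists (rcons t 0%N); split.
    - exact: prefix_trans st (prefix_rcons _ _).
    - by rewrite size_rcons ltnS; exact: size_prefix.
    by left=> b /(thru_prefix _ _ _ (prefix_rcons t 0%N)); exact: nt.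
  exists (rcons s 0%N); split; first exact: prefix_rcons.
    by rewrite size_rcons.
  right=> t st; apply: contrapT => nb; apply: ns; exists t; split.
    exact: prefix_trans (prefix_rcons _ _) st.
  by move=> b tb bk; apply: nb; exists b.
have [F FP] := choice step.
(* Stage [i] treats the pair coded by [i]; codes of no pair fall back on a harmless default. *)
pose e i : nat * nat := odflt (0%N, 0%N) (unpickle i).
pose S := fix S i := if i is j.+1 then F (e j, S j) else [::].
have SS i : prefix (S i) (S i.+1) by have [] := FP (e i, S i).
have sizeS i : (i <= size (S i))%N.
  by elim: i => // i IH; have [_ /= lt _] := FP (e i, S i); exact: leq_ltn_trans lt.
have Sle i j : (i <= j)%N -> prefix (S i) (S j).
  move=> /subnKC <-; elim: (j - i)%N => [|k IH]; first by rewrite addn0 prefix_refl.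
  by rewrite addnS; exact: prefix_trans (SS _).
have nthS i j k : (i <= j)%N -> (k < size (S i))%N -> nth 0%N (S i) k = nth 0%N (S j) k.
  by move=> /Sle/prefixP[u ->] ki; rewrite nth_cat ki.
pose a k := nth 0%N (S k.+1) k.
have aS i : thru (S i) a.
  apply: (@eq_from_nth _ 0%N); rewrite size_mkseq// => k ki.
  rewrite nth_mkseq// /a.
  have [ik|/ltnW ki'] := leqP i k.+1; first exact/esym/nthS.
  exact: nthS.
(* At the stage of the pair [(n, tau n a)] the excluding alternative is impossible, because [a]
   itself passes through [S i.+1]. *)
exists a => n; pose i := pickle (n, tau n a).
have [_ _] := FP (e i, S i); rewrite -[F _]/(S i.+1) /e pickleK/=.
move=> [/(_ _ (aS i.+1))//|dense].
by exists (size (S i.+1)) => t; rewrite aS; exact: dense.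
Qed.

(** * The forcing relation *)

Section forcing_relation.
Variable Q : forcing.
Implicit Types (q r : Q) (phi psi : sentence Q).
Local Open Scope forcing_scope.

Definition monotone phi : Prop := forall q r, q ≼ r -> phi q -> phi r.

(** Truth at densely many conditions above [q] gives truth at [q], as for a Boolean value. *)
Definition stable phi : Prop :=
  monotone phi /\ (forall q, (forall r, q ≼ r -> exists2 s, r ≼ s & phi s) -> phi q).

Lemma stable_monotone phi : stable phi -> monotone phi.
Proof. by case. Qed.

Lemma stable_mem X (x : X) (A : name Q X) : stable (x ∈ A).
Proof.
split=> [q r qr xA s rs|q h r qr]; first by apply: xA; exact: fle_trans rs.
have [s rs xA] := h r qr; have [t st [c cA ct]] := xA s (fle_refl s).
by exists t; [exact: fle_trans st|exists c].
Qed.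

Lemma monotone_not phi : monotone (¬ phi).
Proof. by move=> q r qr nphi s rs; apply: nphi; exact: fle_trans rs. Qed.

Lemma stable_not phi : monotone phi -> stable (¬ phi).
Proof.
move=> mphi; split=> [|q h r qr phir]; first exact: monotone_not.
by have [s rs nphi] := h r qr; apply: (nphi s (fle_refl s)); exact: mphi phir.
Qed.

Lemma monotone_and phi psi : monotone phi -> monotone psi -> monotone (phi ∧ psi).
Proof. by move=> mphi mpsi q r qr [phiq psiq]; split; [exact: mphi phiq|exact: mpsi psiq]. Qed.

Lemma monotone_all X (phi : X -> sentence Q) :
  (forall x, monotone (phi x)) -> monotone (∀ x, phi x).
Proof. by move=> mphi q r qr phiq x; exact: mphi (phiq x). Qed.

Lemma monotone_imp phi psi : monotone (phi ⇒ psi).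
Proof. exact: monotone_not. Qed.

Lemma monotone_ex X (phi : X -> sentence Q) : monotone (∃ x, phi x).
Proof. exact: monotone_not. Qed.

Lemma stable_ex X (phi : X -> sentence Q) : stable (∃ x, phi x).
Proof. by apply: stable_not; apply: monotone_all => x; exact: monotone_not. Qed.

Lemma forces_imp q phi psi :
  (forall r, q ≼ r -> phi r -> psi r) -> forces q (phi ⇒ psi).
Proof. by move=> h r qr [phir npsi]; apply: (npsi r (fle_refl r)); exact: h. Qed.

(** The implication is [¬ (phi ∧ ¬ psi)], which yields [psi] only densely; stability recovers it at
    [q]. *)
Lemma forces_mp q phi psi :
  monotone phi -> stable psi -> forces q (phi ⇒ psi) -> forces q phi -> forces q psi.
Proof.
move=> mphi spsi imp phiq; apply: spsi.2 => r qr; apply: contrapT => npsi.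
apply: (imp r qr); split; first exact: mphi phiq.
by move=> s rs psis; apply: npsi; exists s.
Qed.

(** The quantifier is [¬ ∀ ¬], so a witness appears only at a stronger condition. *)
Lemma forces_exE X (phi : X -> sentence Q) q :
  forces q (∃ x, phi x) -> exists x r, q ≼ r /\ forces r (phi x).
Proof.
move=> h; apply: contrapT => nx; apply: (h q (fle_refl q)) => x r qr phir.
by apply: nx; exists x, r.
Qed.

End forcing_relation.

(** * Random forcing *)

Definition xor k (s t : {ffun 'I_k -> bool}) : {ffun 'I_k -> bool} :=
  [ffun i => s i (+) t i].

Lemma xorC k (s t : {ffun 'I_k -> bool}) : xor s t = xor t s.
Proof. by apply/ffunP => i; rewrite !ffunE addbC. Qed.

Lemma xorK k (s : {ffun 'I_k -> bool}) : involutive (xor s).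
Proof. by move=> t; apply/ffunP => i; rewrite !ffunE addbA addbb addFb. Qed.

Lemma closed_res_family k (K : {ffun 'I_k -> bool} -> set cantor_space) :
  (forall s, closed (K s)) -> closed [set z | K (res k z) z].
Proof.
move=> cK; rewrite (_ : [set z | _] = \bigcap_s ([set z | res k z <> s] `|` K s)).
  by apply: closed_bigI => s _; apply: closedU => //; exact: (@closed_res k (fun u => u <> s)).
apply/seteqP; split=> z /= h; last by have [] := h (res k z) I.
by move=> s _; have [<-|] := pselect (res k z = s); [right|left].
Qed.

Lemma card_xor k (t : {ffun 'I_k -> bool}) (P : pred {ffun 'I_k -> bool}) :
  #|[pred s | P (xor t s)]| = #|P|.
Proof. by rewrite -[RHS]sum1_card (reindex_inj (can_inj (xorK t))) sum1_card. Qed.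

Lemma measurable_res_family k (H : {ffun 'I_k -> bool} -> set cantor_space) :
  (forall s, measurable (H s : set cantor_borel)) ->
  measurable ([set z | H (res k z) z] : set cantor_borel).
Proof.
move=> mH.
rewrite (_ : [set z | _] = \bigcup_s ([set z | res k z = s] `&` H s)).
  apply: countable_bigcupT_measurable; first exact: countableP.
  move=> s; apply: measurableI => //; apply: open_measurable_cantor.
  exact: (@open_res k (fun u => u = s)).
by apply/seteqP; split=> z /= => [Hz|[s _ [/= ->]]] //; exists (res k z).
Qed.

Section random.
Variable R : realType.
Local Notation m := (@prob R).
Local Notation meas A := (measurable (A : set cantor_borel)).
Local Notation Q := (random_forcing R).

(** [H u] may depend on the bits that select [u], so no independence is available. For a fixed value
    of [res k z] the shifts run through all [u]; hence the average over [t] is at most [e], and some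
    [t] does as well. *)
Lemma average_shift k (H : {ffun 'I_k -> bool} -> set cantor_space) (e : R) :
  (forall u, meas (H u)) -> (forall u, m (H u) <= e) ->
  exists t, m [set z | H (xor t (res k z)) z] <= e.
Proof.
move=> mH He; have mS s : meas [set z | res k z = s].
  by apply: open_measurable_cantor; exact: (@open_res k (fun u => u = s)).
have mHt t : meas [set z | H (xor t (res k z)) z].
  exact: (@measurable_res_family k (fun s => H (xor t s))).
apply: contrapT => /forallNP nt.
have : \sum_(t : {ffun 'I_k -> bool}) e <
    \sum_(t : {ffun 'I_k -> bool}) m [set z | H (xor t (res k z)) z].
  apply: ltr_sum; first by apply/hasP; exists [ffun=> false] => //; rewrite mem_index_enum.
  by move=> t _; rewrite ltNge; apply/negP/nt.
rewrite ltNge => /negP; apply.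
under eq_bigr do rewrite (prob_partition R (mHt _) mS).
rewrite exchange_big/=.
have -> : \sum_s \sum_t m ([set z | H (xor t (res k z)) z] `&` [set z | res k z = s]) =
    \sum_s \sum_u m (H u `&` [set z | res k z = s]).
  apply: eq_bigr => s _; rewrite (reindex_inj (can_inj (xorK s)))/=.
  apply: eq_bigr => t _; congr (m _); apply/seteqP.
  by split=> z /= [Hz zs]; split=> //; move: Hz; rewrite zs xorC xorK.
rewrite exchange_big/=; apply: ler_sum => u _.
by rewrite -(prob_partition R (mH u) mS).
Qed.

Lemma random_prob_gt0 (r : Q) : 0 < m (sval r).
Proof. by have := above_cond r; rewrite lte_fin. Qed.

Lemma random_of_closed (F : set cantor_space) :
  closed F -> 0 < m F -> exists r : Q, sval r = F.
Proof.
move=> cF F0; have aF : (0 < leb R F)%E.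
  by rewrite lebE ?lte_fin//; exact: closed_measurable_cantor.
by exists (exist _ F (conj cF aF)).
Qed.

(* Up to a small error, K plays the role of the Boolean value of [phi]. *)
Lemma closed_boolean_value (phi : sentence Q) (e : R) : stable phi -> 0 < e ->
  exists K, [/\ closed K, forall r : Q, sval r `<=` K -> phi r &
    forall r : Q, phi r -> m (sval r `\` K) < e].
Proof.
move=> [mphi sphi] e0.
have mcond (r : Q) := closed_measurable_cantor (closed_cond (F := r)).
pose good K := closed K /\ forall r : Q, sval r `<=` K -> phi r.
(* A condition included in the union meets [K] or [L] in positive measure, so [phi] holds densely
   above it. *)
have goodU K L : good K -> good L -> good (K `|` L).
  move=> [cK gK] [cL gL]; split=> [|r rKL]; first exact: closedU.
  apply: sphi => s rs.
  have sKL : sval s `<=` K `|` L by move=> z /rs/rKL.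
  have cs := closed_cond (F := s).
  have cI A : closed A -> closed (sval s `&` A) by move=> cA; exact: closedI.
  have [sK|sK] := ltP 0 (m (sval s `&` K)).
    have [t tE] := random_of_closed (cI _ cK) sK; exists t.
      by rewrite /fle/= /closed_above_le tE => z [].
    by apply: gK; rewrite tE => z [].
  have sL : 0 < m (sval s `&` L).
    have mI A : closed A -> meas (sval s `&` A).
      by move=> cA; apply: closed_measurable_cantor; exact: cI.
    have := prob_setU_le R (mI _ cK) (mI _ cL).
    rewrite -setIUr (_ : sval s `&` (K `|` L) = sval s); last by apply/setIidPl.
    by have := random_prob_gt0 s; lra.
  have [t tE] := random_of_closed (cI _ cL) sL; exists t.
    by rewrite /fle/= /closed_above_le tE => z [].
  by apply: gL; rewrite tE => z [].
pose E : set R := [set x | exists2 K, good K & m K = x].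
have E1 x : E x -> x <= 1.
  move=> [K [cK _] <-]; rewrite -(probT R); apply: le_prob => //.
  exact: closed_measurable_cantor.
have supE : has_sup E.
  split; last by exists 1 => x /E1.
  exists (m set0), set0 => //; split=> [|r r0]; first exact: closed0.
  have := random_prob_gt0 r; rewrite (_ : sval r = set0) ?/prob ?measure0 ?ltxx//.
  by apply/seteqP; split.
(* [K] nearly attains the supremum of the measures of good sets; adding to it a condition forcing
   [phi] keeps it good, so gains less than [e]. *)
have [_ [K gK <-] Ke] := sup_adherent e0 supE.
exists K; split; [exact: gK.1|exact: gK.2|move=> r phir].
have gr : good (sval r).
  by split=> [|s rs]; [exact: closed_cond|exact: mphi phir].
have gU := goodU _ _ gK gr.
have := sup_upper_bound supE (ex_intro2 _ _ _ gU erefl).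
have mK := closed_measurable_cantor gK.1.
rewrite (prob_setD R (closed_measurable_cantor gU.1) mK).
rewrite (_ : (K `|` sval r) `&` K = K); last by apply/setIidPr => z; left.
rewrite (_ : (K `|` sval r) `\` K = sval r `\` K); first by lra.
by apply/seteqP; split=> z [Kr nK]; split=> //; [case: Kr|right].
Qed.

Lemma random_borel_cantelli (c : Q) (G : nat -> set cantor_space) (C : R) :
  (forall n, closed (G n)) -> (forall N, \sum_(n < N) m (sval c `\` G n) <= C) ->
  exists (c' : Q) N, c ≼ c' /\ forall n, (N <= n)%N -> sval c' `<=` G n.
Proof.
move=> cG sumC; have cc := closed_cond (F := c).
have [N cN] := borel_cantelli_above (closed_measurable_cantor cc)
  (fun n => closed_measurable_cantor (cG n)) (random_prob_gt0 c) sumC.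
have [|c' c'E] := random_of_closed _ cN.
  by apply: closedI => //; apply: closed_bigI.
exists c', N; rewrite /fle/= /closed_above_le c'E; split=> [z []//|n Nn z [_]]; exact.
Qed.

End random.

(** * A sequence chosen by the random real *)

Section random_sequence.
Variable R : realType.
Local Notation m := (@prob R).
Local Notation meas A := (measurable (A : set cantor_borel)).
Local Notation Q := (random_forcing R).

(** Different lists contain nodes of different lengths, so their concatenation has no repetition;
    [F] lies in its [avoid], and [prob_avoid] applies. *)
Lemma node_sets_avoided (l : nat -> seq (seq nat)) (F : set cantor_space) N :
  meas F -> 0 < m F -> (forall n, uniq (l n)) ->
  (forall n s k t, s \in l n -> t \in l k -> size s = size t -> n = k) ->
  (forall n s, s \in l n -> F `&` node_set s = set0) ->
  \sum_(n < N) \sum_(s <- l n) 4 ^- size s <= (m F)^-1 :> R.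
Proof.
move=> mF F0 ul sl Fl.
pose L := fix L n := if n is k.+1 then l k ++ L k else [::].
have memL n s : s \in L n -> exists2 k, (k < n)%N & s \in l k.
  elim: n => //= n IH; rewrite mem_cat => /orP[sn|/IH[k kn sk]]; first by exists n.
  by exists k => //; exact: ltnW.
have uL n : uniq (L n).
  elim: n => //= n IH; rewrite cat_uniq ul IH andbT/=; apply/hasPn => s /memL[k kn sk].
  by apply/negP => sn; have := sl _ _ _ _ sk sn erefl => kE; move: kn; rewrite kE ltnn.
have sumL n : \sum_(s <- L n) 4 ^- size s = \sum_(k < n) \sum_(s <- l k) 4 ^- size s :> R.
  elim: n => [|n IH]; first by rewrite big_nil big_ord0.
  by rewrite /= big_cat/= IH big_ord_recr/= addrC.
rewrite -sumL.
have [n dL] := avoid_determined (L N).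
have FL : m F <= m (avoid (L N)).
  apply: le_prob => //; first exact: open_measurable_cantor (determined_open dL).
  move=> z Fz s /memL[k _ sk] nz.
  by have : (F `&` node_set s) z by []; rewrite (Fl _ _ sk).
have S0 : 0 <= \sum_(s <- L N) 4 ^- size s :> R.
  by apply: sumr_ge0 => s _; rewrite invr_ge0 exprn_ge0.
rewrite -[leRHS]mul1r ler_pdivlMr// mulrC.
have := prob_avoid R (uL N); nra.
Qed.

(** [p n z] is the [n]-th term read off from the generic real [z]. The clauses provide convergence
    to [d a], the absence of a bound for infinitely many terms, and names for the terms. *)
Lemma random_sequence (X : Type) (phi : X -> nat -> sentence Q) (d : (nat -> nat) -> X) :
  (forall x j, stable (phi x j)) ->
  exists a (p : nat -> cantor_space -> X),
  [/\ forall j c, phi (d a) j c -> exists (c' : Q) N, c ≼ c' /\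
        forall n, (N <= n)%N -> forall r x, c' ≼ r -> (forall z, sval r z -> p n z = x) ->
          phi x j r,
      forall (F : set cantor_space) (c : Q), closed F -> 0 < m F ->
        exists (c' : Q) N, c ≼ c' /\ forall n, (N <= n)%N -> forall z, sval c' z ->
          exists2 b, p n z = d b & ~ F `<=` branch_set b
    & forall n, exists k, forall z y, res k z = res k y -> p n z = p n y].
Proof.
move=> sphi; pose eps n : R := 4 ^- n.+1.
have eps0 n : 0 < eps n by rewrite invr_gt0 exprn_gt0.
have /choice[K KP] : forall nxj : nat * X * nat, exists K, [/\ closed K,
    forall r : Q, sval r `<=` K -> phi nxj.1.2 nxj.2 r &
    forall r : Q, phi nxj.1.2 nxj.2 r -> m (sval r `\` K) < eps nxj.1.1].
  by move=> [[n x] j]; exact: closed_boolean_value.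
have cK nxj : closed (K nxj) by have [] := KP nxj.
have mK nxj : meas (K nxj) by exact: closed_measurable_cantor.
have /choice[S SP] : forall nxj, exists c : {n & {set {ffun 'I_n -> bool}}},
    K nxj `<=` clopen_set c /\ m (clopen_set c `\` K nxj) < eps nxj.1.1.
  move=> nxj; have [k [C CP]] := prob_closed_approx (cK nxj) (eps0 nxj.1.1).
  by exists (existT _ k C).
have mS c : meas (clopen_set c).
  by apply: open_measurable_cantor; exact: (@open_res (tag c) (fun s => s \in tagged c)).
(* [tau n] records the clopen approximations for [j <= n]: unlike the sets [K], they take countably
   many values, as the category argument needs. *)
pose tau n b := pickle [seq S (n, d b, j) | j <- iota 0 n.+1].
have tauS n b b' j : tau n b = tau n b' -> (j <= n)%N -> S (n, d b, j) = S (n, d b', j).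
  move=> /(pcan_inj pickleK)/eq_in_map/(_ j); rewrite mem_iota add0n ltnS; exact.
have [a aP] := baire_dense_pieces tau.
have [M MP] := choice aP.
(* [M n <= h n] gives density above the branching node, and strict growth gives distinct lengths for
   distinct [n]. *)
pose h n := (n + \sum_(i < n.+1) M i)%N.
have Mh n : (M n <= h n)%N by rewrite /h big_ord_recr/= addnA leq_addl.
have hS n : (h n < h n.+1)%N by rewrite /h [in leqRHS]big_ord_recr/=; lia.
have h_inj : injective h.
  move=> n k; have hlt i j : (i < j)%N -> (h i < h j)%N.
    exact: (homo_ltn ltn_trans hS).
  by case: (ltngtP n k) => // /hlt; lia.
(* There are [2 ^ k n = 4 ^ (h n).+1] choices, so each child has as probability the measure of its
   node set. *)
pose k n := (h n).+1.*2.
pose node n (u : {ffun 'I_(k n) -> bool}) := rcons (mkseq a (h n)) (enum_rank u).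
have node_inj n : injective (@node n).
  by move=> u v /rcons_inj[/ord_inj/enum_rank_inj].
have size_node n u : size (@node n u) = (h n).+1 by rewrite size_rcons size_mkseq.
have B n u : {b | mkseq b (h n).+1 = @node n u /\ tau n b = tau n a}.
  apply: cid; have [|b bt tb] := MP n (node n u); last first.
    by exists b; rewrite -(size_node n u).
  apply: (@prefix_trans _ (mkseq a (h n))); last exact: prefix_rcons.
  by rewrite -(subnKC (Mh n)) /mkseq iotaD map_cat; exact: prefix_prefix.
pose b n u := sval (B n u).
(* The error of choice [u]: points of the clopen approximations for [d a] outside the approximate
   Boolean values for [d (b n u)]. *)
pose H n u := \bigcup_(j < n.+1) (clopen_set (S (n, d a, j)) `\` K (n, d (b n u), j)).
have mH n u : meas (H n u).
  by apply: bigcup_measurable => j _; exact: measurableD.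
have He n u : m (H n u) <= n.+1%:R * eps n.
  apply: prob_bigcup_le => [j|j jn]; first exact: measurableD.
  rewrite -(tauS n (b n u) a j (svalP (B n u)).2 jn); exact/ltW/(SP _).2.
have T n := cid (average_shift (mH n) (He n)).
pose v n z := xor (sval (T n)) (res (k n) z).
have vE n z y : res (k n) z = res (k n) y -> v n z = v n y by rewrite /v => ->.
exists a, (fun n z => d (b n (v n z))); split; last first.
- by move=> n; exists (k n) => z y zy; rewrite (vE n z y zy).
- move=> F c cF F0; have mF := closed_measurable_cantor cF.
  (* [U n] collects the bad choices, those whose node set misses [F]. *)
  pose U n : pred {ffun 'I_(k n) -> bool} := fun u => `[< F `&` node_set (node n u) = set0 >].
  pose G n := [set z | ~ U n (v n z)].
  have cG n : closed (G n).
    exact: (@closed_res (k n) (fun s => ~ U n (xor (sval (T n)) s))).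
  pose l n := [seq node n u | u <- enum (U n)].
  have [|c' [N [cc' c'G]]] := @random_borel_cantelli R c G (m F)^-1 cG.
    move=> N; have l_size n s : s \in l n -> size s = (h n).+1 by move=> /mapP[u _ ->].
    apply: le_trans (@node_sets_avoided l F N mF F0 _ _ _); last first.
    + by move=> n s /mapP[u]; rewrite mem_enum => /asboolP Fu ->.
    + by move=> n s n' t /l_size -> /l_size -> [/h_inj].
    + by move=> n; rewrite map_inj_uniq ?enum_uniq//; exact: node_inj.
    (* The probability of a bad choice is the sum of [4 ^- size s] over the bad nodes, a uniform
       choice being unaffected by the shift. *)
    apply: ler_sum => n _; apply: (@le_trans _ _ (m [set z | U n (v n z)])).
      apply: le_prob.
      * by apply: measurableD; apply: closed_measurable_cantor; [exact: closed_cond|exact: cG].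
      * apply: open_measurable_cantor.
        exact: (@open_res (k n) (fun s => U n (xor (sval (T n)) s))).
      * by move=> z [_ /contrapT].
    rewrite (prob_res R (fun s => U n (xor (sval (T n)) s))).
    rewrite /l big_map big_enum/= (eq_bigr (fun=> 2 ^- k n)).
      by rewrite sumr_const (card_xor _ (U n)) mulr_natl.
    by move=> u _; rewrite size_node -expr_double_four.
  exists c', N; split=> // n Nn z /(c'G n Nn) Gz; exists (b n (v n z)) => // FB.
  apply: Gz; apply/asboolP; apply/seteqP; split=> // y [/FB By ny].
  by apply: (By (h n)); rewrite (svalP (B n (v n z))).1.
move=> j c phic.
(* For [n < j] the index [j] is not recorded by [tau n], so nothing is required. *)
pose G n := if (n < j)%N then setT else [set z | K (n, d (b n (v n z)), j) z].
have cG n : closed (G n).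
  rewrite /G; case: ifP => _; first exact: closedT.
  exact: (@closed_res_family (k n) (fun s => K (n, d (b n (xor (sval (T n)) s)), j))).
have mG n := closed_measurable_cantor (cG n).
have mc := closed_measurable_cantor (closed_cond (F := c)).
have [|c' [N [cc' c'G]]] := @random_borel_cantelli R c G 1 cG.
  move=> N; apply: le_trans (sum_half_le1 R N).
  apply: ler_sum => -[n nN] _ /=; have [nj|jn] := ltnP n j.
    by rewrite /G nj setDT /prob measure0 invr_ge0 exprn_ge0.
  apply: (le_trans (le_probD R mc (mK (n, d a, j)) (mG n))).
  have cKa : m (sval c `\` K (n, d a, j)) <= eps n.
    by have [_ _ /(_ c phic)/ltW] := KP (n, d a, j).
  have KG : m (K (n, d a, j) `\` G n) <= n.+1%:R * eps n.
    apply: le_trans (svalP (T n)); apply: le_prob.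
    + exact: measurableD.
    + exact: (@measurable_res_family (k n) (fun s => H n (xor (sval (T n)) s))).
    rewrite /G ltnNge jn/= => z [Kz nK]; exists j => //=.
    by split=> //; exact: (SP _).1.
  (* The two errors add up to [n.+2 * 4 ^- n.+1], at most [2 ^- n.+1] because [n.+1 < 2 ^ n.+1]. *)
  apply: (le_trans (lerD cKa KG)); rewrite -[X in X + _]mul1r -mulrDl nat1r /eps.
  rewrite -expr_double_four -addnn exprD invfM mulrA ler_piMl ?invr_ge0 ?exprn_ge0//.
  by rewrite ler_pdivrMr ?exprn_gt0// mul1r -natrX ler_nat; exact: ltn_expl.
exists c', (maxn N j); split=> // n; rewrite geq_max => /andP[Nn jn] r x c'r rx.
have [_ Kphi _] := KP (n, x, j); apply: Kphi => z rz.
have := c'G n Nn z (c'r z rz); rewrite /G ltnNge jn/=.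
by rewrite (rx z rz).
Qed.

End random_sequence.

(** * The quotient *)

Section quotient.
Variables (R : realType) (a : \bar R).
Hypothesis a1 : (a < 1)%E.
Hypothesis a0 : (0 <= a)%E.
Hypothesis a2 : (a <= (2^-1)%:E)%E.
Local Notation m := (@prob R).
Local Notation Q := (random_forcing R).
Local Notation A := (closed_above_forcing a1).
Local Notation P := (prod_forcing Q A).
Local Notation E := (quotient (@fst_embedding Q A)).

Fact branch_condP b : closed (branch_set b) /\ (a < leb R (branch_set b))%E.
Proof.
split; first exact: closed_branch_set.
rewrite lebE; last exact: closed_measurable_cantor (@closed_branch_set b).
by apply: le_lt_trans a2 _; rewrite lte_fin; exact: prob_branch_set.
Qed.

Definition branch_cond b : A := exist _ (branch_set b) (branch_condP b).

(** [(r, F)] is a common extension of [(fbot, F)] and [(r, fbot)]. *)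
Lemma forces_fbot_quotient (q : Q) (F : A) : forces q (((fbot, F) : P) ∈ E)%F.
Proof.
apply/forces_quotient => [r s rs|r _]; first by split=> //=; exact: fle_refl.
exists (BA_embed ((r, F) : P)); split.
- exact: regular_open_BA_embed.
- by exists (r, F) => x rx; exists x => //; exact: fle_refl.
- by apply: BA_embed_anti; split; [exact: fbot_le|exact: fle_refl].
- by apply: BA_embed_anti; split; [exact: fle_refl|exact: fbot_le].
Qed.

Lemma random_nonempty (r : Q) : exists z, sval r z.
Proof.
apply: contrapT => r0; have := random_prob_gt0 r.
rewrite (_ : sval r = set0) ?/prob ?measure0 ?ltxx//.
by apply/seteqP; split=> // z rz; apply: r0; exists z.
Qed.

(** One of the finitely many pieces of [r] on which [res k] is constant has positive measure. *)
Lemma random_constant X k (f : cantor_space -> X) (r : Q) :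
  (forall z y, res k z = res k y -> f z = f y) ->
  exists (s : Q) x, r ≼ s /\ forall z, sval s z -> f z = x.
Proof.
move=> fk.
have cs u : closed [set z | res k z = u] by exact: (@closed_res k (fun v => v = u)).
have mr := closed_measurable_cantor (closed_cond (F := r)).
have := random_prob_gt0 r.
rewrite (prob_partition R mr (fun u => closed_measurable_cantor (cs u))) => sum0.
have [u u0] : exists u, 0 < m (sval r `&` [set z | res k z = u]).
  apply: contrapT => /forallNP nu; move: sum0; rewrite ltNge => /negP; apply.
  by apply: sumr_le0 => u _; rewrite leNgt; apply/negP/nu.
have [|s sE] := random_of_closed _ u0.
  by apply: closedI => //; exact: closed_cond.
have [y] := random_nonempty s; rewrite sE => -[_ yu].
exists s, (f y); rewrite /fle/= /closed_above_le sE.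
by split=> z [] // _ zu; apply: fk; rewrite zu.
Qed.

(** The bounds on [a] cover random forcing and amoeba at once. If [B] witnessed sweetness, some [r]
    would bound infinitely many terms of a random sequence converging to [d b], and [r.2] would lie
    in branch sets that it cannot lie in. *)
Lemma no_dense_sweet_quotient : forced (no_dense_subforcing_sweet E).
Proof.
move=> q D; apply: forces_imp => q1 _ dense q2 q12 /forces_exE[wk [q3 [q23 [_ ]]]].
move=> /forces_exE[B [q4 [q34 [base [_ sweet]]]]].
have /choice[dc dcP] : forall b, exists dc : P * Q,
    [/\ q4 ≼ dc.2, forces dc.2 (dc.1 ∈ D)%F & ((fbot, branch_cond b) : P) ≼ dc.1].
  move=> b; have := dense.2 (fbot, branch_cond b).
  have q14 := fle_trans q12 (fle_trans q23 q34).
  move=> /(monotone_imp q14) imp.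
  have := forces_mp (stable_monotone (stable_mem _ _)) (stable_ex _) imp
    (@forces_fbot_quotient q4 (branch_cond b)).
  move=> /forces_exE.
  by move=> [x [c [q4c [xD bx]]]]; exists (x, c).
pose d b := (dc b).1.
(* Index 0 stands for membership in [D], index [i.+1] for membership in the [i]-th basic set. *)
pose phi (x : P) j : sentence Q := (if j is i.+1 then (i, x) ∈ B else x ∈ D)%F.
have sphi x j : stable (phi x j) by case: j => [|j]; exact: stable_mem.
have [b [p [conv unb loc]]] := random_sequence d sphi.
have [q4c cD _] := dcP b.
have [c1 [N1 [cc1 c1D]]] := conv 0%N _ cD.
have q41 := fle_trans q4c cc1.
(* Terms before [N1] may fall outside [D]; they are replaced by [d b]. *)
pose p' n z := if (n < N1)%N then d b else p n z.
(* A condition puts [(n, x)] into the graph when [p' n] is constantly [x] on it. *)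
pose S : name Q (nat * P) := fun nx c => forall z, sval c z -> p' nx.1 z = nx.2.
have pE n z : (N1 <= n)%N -> p' n z = p n z by rewrite /p' ltnNge => ->.
have loc' n r : exists (s : Q) x, r ≼ s /\ forall z, sval s z -> p' n z = x.
  have [k pk] := loc n; apply: (@random_constant _ k) => z y zy.
  by rewrite /p' (pk z y zy).
have memS n x (w : Q) : (forall z, sval w z -> p' n z = x) -> forces w ((n, x) ∈ S)%F.
  by move=> wx r wr; exists r; [exact: fle_refl|exists w].
have Smem n x (u v : Q) : forces u ((n, x) ∈ S)%F -> u ≼ v ->
    exists2 w : Q, v ≼ w & forall z, sval w z -> p' n z = x.
  by move=> uS uv; have [s vs [c Sc cs]] := uS v uv; exists s => // z /cs; exact: Sc.
have bD : forces c1 (d b ∈ D)%F by exact: (stable_monotone (stable_mem _ _)) cc1 cD.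
have p'D n x (r : Q) : c1 ≼ r -> (forall z, sval r z -> p' n z = x) -> forces r (x ∈ D)%F.
  move=> c1r; rewrite /p'; case: ltnP => nN rx; last exact: (c1D n nN r x c1r rx).
  have [z rz] := random_nonempty r; rewrite -(rx z rz).
  exact: (stable_monotone (stable_mem _ _)) c1r bD.
have seqS : forces c1 (fsequence D S).
  split; [|split].
  - move=> n x; apply: forces_imp => r c1r xS; apply: (stable_mem _ _).2 => s rs.
    have [w sw wx] := Smem _ _ _ _ xS rs; exists w => //.
    exact: (p'D n) (fle_trans c1r (fle_trans rs sw)) wx.
  - move=> n r c1r nx; have [s [x [rs sx]]] := loc' n r.
    by apply: (nx x s rs); exact: memS.
  - move=> n x y; apply: forces_imp => r _ [xS yS].
    have [w rw wx] := Smem _ _ _ _ xS (fle_refl r).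
    have [v wv vy] := Smem _ _ _ _ yS rw.
    have [z vz] := random_nonempty v.
    by rewrite /fground -(vy z vz) -(wx z (wv z vz)).
have cvgS : forces c1 (fcvg D B S (d b)).
  move=> W; apply: forces_imp => r c1r [_ nbW] s rs nN.
  have [i [t [st [biB iW]]]] := forces_exE (monotone_ex rs nbW).
  have [t' [N [tt' t'N]]] := conv i.+1 t biB.
  apply: (nN (maxn N N1) t' (fle_trans st tt')) => n x.
  apply: forces_imp => u t'u [/= +  xS]; rewrite /fground geq_max => /andP[Nn N1n].
  apply: (stable_mem _ _).2 => v uv.
  have [w vw wx] := Smem _ _ _ _ xS uv; exists w => //.
  have t'w := fle_trans t'u (fle_trans uv vw).
  have xB : forces w ((i, x) ∈ B)%F.
    by apply: (t'N n Nn w x t'w) => z wz; rewrite -pE// wx.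
  exact: (forces_mp (stable_monotone (stable_mem _ _)) (stable_mem _ _)
    (monotone_imp (fle_trans tt' t'w) (iW x)) xB).
have nbD : forces c1 (fnbhd D B (d b) D).
  split; first by move=> x; apply: forces_imp.
  have bB := forces_mp (stable_monotone (stable_mem _ _)) (stable_ex _)
    (monotone_imp q41 (base.2.1 (d b))) bD.
  move=> s c1s nn; have [i [t [st biB]]] := forces_exE (monotone_ex c1s bB).
  apply: (nn i t st); split=> // y.
  exact: monotone_imp (fle_trans q41 (fle_trans c1s st)) (base.1 i y).
have hyp : monotone (fsequence D S ∧ d b ∈ D ∧ fcvg D B S (d b) ∧ d b ∈ D ∧
    « d b ≼ d b » ∧ fnbhd D B (d b) D)%F.
  have mD : monotone (d b ∈ D)%F := stable_monotone (stable_mem _ _).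
  have mS : monotone (fsequence D S).
    apply: monotone_and; first by do 2! apply: monotone_all => ?; exact: monotone_imp.
    apply: monotone_and; first by apply: monotone_all => ?; exact: monotone_ex.
    by do 3! apply: monotone_all => ?; exact: monotone_imp.
  have mc : monotone (fcvg D B S (d b)) by apply: monotone_all => ?; exact: monotone_imp.
  have mn : monotone (fnbhd D B (d b) D).
    apply: monotone_and; last exact: monotone_ex.
    by apply: monotone_all => ?; exact: monotone_imp.
  by do 5! [apply: monotone_and => //].
(* Sweetness is applied with limit and upper condition both [d b], and with neighbourhood [D]. *)
have [r [c2 [c12 [_ [_ inf]]]]] := forces_exE (forces_mp hyp (stable_ex _)
  (monotone_imp q41 (sweet S (d b) (d b) D))
  (conj seqS (conj bD (conj cvgS (conj bD (conj (fle_refl _) nbD)))))).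
have r0 : 0 < m (sval r.2).
  by have := above_cond r.2; move=> /(le_lt_trans a0); rewrite lte_fin.
have [c3 [N3 [c23 unb3]]] := unb _ c2 (closed_cond (F := r.2)) r0.
have [n [c4 [c34 exS]]] := forces_exE (monotone_ex c23 (inf (maxn N1 N3))).
have [x [c5 [c45 [+ [xS xr]]]]] := forces_exE exS.
rewrite /fground geq_max => /andP[N1n N3n].
have [c6 c56 c6x] := Smem _ _ _ _ xS (fle_refl c5).
have [z c6z] := random_nonempty c6.
have c36 := fle_trans c34 (fle_trans c45 c56).
have [b' pb' nrb'] := unb3 n N3n z (c36 z c6z).
(* The term [x] is [d b'], which extends the branch condition of [b'], and [r] extends [x]; so [r.2]
   is included in the branch set of [b']. *)
apply: nrb'; have [_ _ [_ /= bd]] := dcP b'; rewrite -/(d b') -pb' -pE// c6x// in bd.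
by move=> y ry; apply: bd; exact: xr.2.
Qed.

End quotient.

Theorem corollary4p10 (R : realType) :
  topologically_sweet (prod_forcing (random_forcing R) (random_forcing R)) /\
  topologically_sweet (prod_forcing (amoeba_forcing R) (amoeba_forcing R)) /\
  forced (no_dense_subforcing_sweet
    (quotient (@fst_embedding (random_forcing R) (random_forcing R)))) /\
  forced (no_dense_subforcing_sweet
    (quotient (@fst_embedding (random_forcing R) (amoeba_forcing R)))).
Proof.
have half0 : (0 <= (2^-1 : R)%:E)%E by rewrite lee_fin invr_ge0.
split; first by apply: topologically_sweet_prod; exact: closed_above_sweet.
split; first by apply: topologically_sweet_prod; exact: closed_above_sweet.
by split; apply: no_dense_sweet_quotient.
Qed.
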